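(* Let $F\subseteq\mathbb{R}^n$ be a self-similar set, the attractor of an iterated function system $\{S_i\}_{i\in\mathcal{I}}$ of contracting similarities of $\mathbb{R}^n$, with Hausdorff dimension $s<1$ and not contained in any affine hyperplane. Then the following are equivalent: (1) $F$ satisfies the weak separation property (that is, $\{S_i\}_{i\in\mathcal{I}}$ does); (2) $\mathcal{H}^s(F)>0$; (3) $0<\mathcal{H}^s(F)<\infty$; (4) $F$ is Ahlfors regular; (5) the Hausdorff and Assouad dimensions of $F$ coincide.
   Context: Self-similar set: given a finite collection $\{S_i\}_{i\in\mathcal{I}}$ of similarity maps of $\mathbb{R}^n$ with contraction ratios in $(0,1)$, $F$ is the unique nonempty compact set with $F=\bigcup_{i\in\mathcal{I}}S_i(F)$. $\mathcal{I}^*$ is the set of finite words over $\mathcal{I}$ and $S_{\mathbf{i}}=S_{i_0}\circ\cdots\circ S_{i_{k-1}}$ for $\mathbf{i}=(i_0,\dots,i_{k-1})$. Weak separation property: the identity map is not an accumulation point of the set $\{S_{\mathbf{i}}^{-1}\circ S_{\mathbf{j}}:\mathbf{i},\mathbf{j}\in\mathcal{I}^*\}$ equipped with the uniform norm (the supremum norm for the restrictions of the maps to $[0,1]^n$). $\mathcal{H}^s$ is $s$-dimensional Hausdorff measure. Ahlfors regularity: a bounded set $F$ with Hausdorff dimension $s$ is Ahlfors regular if there is $c\ge1$ such that $c^{-1}r^s\le\mathcal{H}^s(F\cap B(x,r))\le c\,r^s$ for all $x\in F$ and $r\in(0,\mathrm{diam}(F)]$. Assouad dimension: $\dim_{\mathrm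 A}F$ is the infimum of those $\alpha\ge0$ for which there is $C>0$ such that for all $0<r<R$ and $x\in F$ the set $F\cap B(x,R)$ can be covered by at most $C(R/r)^\alpha$ sets of diameter at most $r$. *)

(* Defs.v *)
From HB Require Import structures.
From mathcomp Require Import all_boot all_order all_algebra.
From mathcomp Require Import all_classical all_reals all_analysis.

Set Implicit Arguments.
Unset Strict Implicit.
Unset Printing Implicit Defensive.

Import Order.TTheory GRing.Theory Num.Theory.
Import numFieldNormedType.Exports.

Local Open Scope classical_set_scope.
Local Open Scope ring_scope.

Section Euclidean.
Context {R : realType} {n : nat}.
Implicit Types (x y : 'rV[R]_n) (U A : set 'rV[R]_n).

(* The library norm on 'rV[R]_n is the maximum norm: it gives the right topology
   (hence [compact], [bounded_set], uniform convergence) but not the right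
   distance for similarities, diameters and balls. *)
Definition eucl_norm x : R := Num.sqrt (\sum_(i < n) x 0 i ^+ 2).

Definition eucl_dist x y : R := eucl_norm (x - y).

Definition eucl_cball x (r : R) : set 'rV[R]_n := [set y | eucl_dist x y <= r].

(* The point 0 is added so that diam set0 = 0 rather than -oo. *)
Definition diam U : \bar R :=
  ereal_sup (0%E |` [set (eucl_dist x y)%:E | x in U & y in U]).

Definition affine_hyperplane A : Prop :=
  exists (a : 'rV[R]_n) (b : R),
    a != 0 /\ A = [set x | \sum_(i < n) a 0 i * x 0 i = b].

Definition unit_cube : set 'rV[R]_n := [set x | forall i, 0 <= x 0 i <= 1].

End Euclidean.

Section SelfSimilar.
Context {R : realType} {n : nat} {I : finType}.
Implicit Types (S : I -> 'rV[R]_n -> 'rV[R]_n) (F : set 'rV[R]_n).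

Definition contracting_similarity (f : 'rV[R]_n -> 'rV[R]_n) : Prop :=
  exists2 c : R, 0 < c < 1 &
    forall x y, eucl_dist (f x) (f y) = c * eucl_dist x y.

Definition attractor S F : Prop :=
  [/\ F !=set0, compact F & F = \bigcup_i (S i @` F)].

Definition word_map S (w : seq I) : 'rV[R]_n -> 'rV[R]_n :=
  foldr (fun i g => S i \o g) id w.

(* g = (word_map S u)^-1 \o word_map S v, where h is the two-sided inverse of
   word_map S u. *)
Definition quotient_maps S : set ('rV[R]_n -> 'rV[R]_n) :=
  [set g | exists u v : seq I, exists h : 'rV[R]_n -> 'rV[R]_n,
    [/\ cancel (word_map S u) h, cancel h (word_map S u)
      & g = h \o word_map S v]].

(* {uniform` A -> V} is the space of all functions, with the topology given by
   the supremum over A of the distance between the values. *)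
Definition weak_separation S : Prop :=
  ~ limit_point
      (quotient_maps S : set {uniform` @unit_cube R n -> 'rV[R]_n})
      (id : {uniform` @unit_cube R n -> 'rV[R]_n}).

End SelfSimilar.

Section Dimensions.
Context {R : realType} {n : nat}.
Implicit Types (s : R) (U A F : set 'rV[R]_n).

(* The convention for set0 only matters for s = 0, where 0 `^ 0 = 1: nonempty
   sets then have gauge 1 and the 0-dimensional measure counts points. *)
Definition gauge s U : \bar R :=
  if U == set0 then 0%E else (diam U `^ s)%E.

Definition hausdorff_premeasure s (delta : R) A : \bar R :=
  ereal_inf [set (\sum_(0 <= k <oo) gauge s (U k))%E |
    U in [set U : (set 'rV[R]_n)^nat |
      A `<=` \bigcup_k U k /\ forall k, (diam (U k) <= delta%:E)%E]].

Definition hausdorff_measure s A : \bar R :=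
  ereal_sup [set hausdorff_premeasure s delta A |
    delta in [set delta : R | 0 < delta]].

Definition hausdorff_dim A : \bar R :=
  ereal_inf [set s%:E |
    s in [set s : R | 0 <= s /\ hausdorff_measure s A = 0%E]].

Definition ahlfors_regular F : Prop :=
  exists s : R,
    [/\ bounded_set F, hausdorff_dim F = s%:E &
      exists2 c : R, 1 <= c &
        forall (x : 'rV[R]_n) (r : R), F x -> 0 < r -> (r%:E <= diam F)%E ->
          ((c^-1 * r `^ s)%:E <= hausdorff_measure s (F `&` eucl_cball x r)
             <= (c * r `^ s)%:E)%E].

Definition coverable A (r b : R) : Prop :=
  exists (m : nat) (U : 'I_m -> set 'rV[R]_n),
    [/\ m%:R <= b, A `<=` \bigcup_i U i & forall i, (diam (U i) <= r%:E)%E].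

Definition assouad_exponent F (alpha : R) : Prop :=
  exists2 C : R, 0 < C &
    forall (r r' : R) (x : 'rV[R]_n), 0 < r -> r < r' -> F x ->
      coverable (F `&` eucl_cball x r') r (C * (r' / r) `^ alpha).

Definition assouad_dim F : \bar R :=
  ereal_inf [set alpha%:E |
    alpha in [set alpha : R | 0 <= alpha /\ assouad_exponent F alpha]].

End Dimensions.

(* Main.v *)
(* Everything is reduced to finite covers of F and to finite packings of F by
   cylinders S_w(F), of ratio rho_w.

   If finitely many cylinders have mutually positive distances, then the sum of
   the rho_w^s is at most 1: otherwise it is at least 1 for some exponent t > s,
   and then the covers of F by small sets bound the t-dimensional Hausdorff
   content of F from below. If H^s(F) > 0, the content of F is positive, and F
   contains separated copies of a given ball B(x,r) in F with total s-mass
   comparable to 1; hence separated cylinders inside B(x,r) have sum of rho_w^s at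
   most C r^s. This bounds all local covering numbers of F, which yields that
   H^s(F) is finite, Ahlfors regularity, and Assouad dimension at most s.

   Under weak separation, a ball of radius r meets boundedly many distinct
   cylinder maps of ratio about r, so the covering numbers satisfy
   N(ab) <= gamma N(a) N(b), whence N(r) >= r^-s / gamma because s is the
   dimension; comparing with N(r) <= C r^-s, a cover of F by sets of diameters r_j
   satisfies sum r_j^s >= h > 0.

   If weak separation fails, maps S_u^-1 S_v very close to the identity, suitably
   rescaled, move F by almost constant vectors of length about 1. Composing such
   maps produces magnified pieces of F that contain arbitrarily long chains of
   points progressing in the direction of a coordinate axis, so that the Assouad
   dimension is at least 1. *)

Require Import Defs.
From HB Require Import structures.
From mathcomp Require Import all_boot all_order all_algebra.
From mathcomp Require Import all_classical all_reals all_analysis.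
From mathcomp Require Import finmap ring lra.

Set Implicit Arguments.
Unset Strict Implicit.
Unset Printing Implicit Defensive.

Import Order.TTheory GRing.Theory Num.Theory.
Import numFieldNormedType.Exports.

Local Open Scope classical_set_scope.
Local Open Scope ring_scope.

(** * The Euclidean norm *)

Section Euclid.
Context {R : realType} {n : nat}.
Implicit Types (x y z : 'rV[R]_n).

Definition dot x y : R := \sum_(i < n) x 0 i * y 0 i.

Lemma dotC x y : dot x y = dot y x.
Proof. by apply: eq_bigr => i _; rewrite mulrC. Qed.

Lemma dotDl x y z : dot (x + y) z = dot x z + dot y z.
Proof. by rewrite -big_split; apply: eq_bigr => i _; rewrite mxE mulrDl. Qed.

Lemma dotZl a x y : dot (a *: x) y = a * dot x y.
Proof. by rewrite mulr_sumr; apply: eq_bigr => i _; rewrite mxE mulrA. Qed.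

Lemma dotDr x y z : dot x (y + z) = dot x y + dot x z.
Proof. by rewrite dotC dotDl !(dotC _ x). Qed.

Lemma dotZr a x y : dot x (a *: y) = a * dot x y.
Proof. by rewrite dotC dotZl dotC. Qed.

Lemma dotNl x y : dot (- x) y = - dot x y.
Proof. by rewrite -scaleN1r dotZl mulN1r. Qed.

Lemma dotNr x y : dot x (- y) = - dot x y.
Proof. by rewrite dotC dotNl dotC. Qed.

Lemma dot0l x : dot 0 x = 0.
Proof. by rewrite -(scale0r x) dotZl mul0r. Qed.

Lemma dot0r x : dot x 0 = 0.
Proof. by rewrite dotC dot0l. Qed.

Lemma dot_ge0 x : 0 <= dot x x.
Proof. by apply: sumr_ge0 => i _; rewrite -expr2 sqr_ge0. Qed.

Lemma dot_eq0 x : dot x x = 0 -> x = 0.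
Proof.
move=> /eqP; rewrite psumr_eq0 => [/allP h|i _]; last by rewrite -expr2 sqr_ge0.
apply/rowP => i; rewrite mxE; apply/eqP.
by have := h i (mem_index_enum _); rewrite -expr2 sqrf_eq0.
Qed.

Lemma sqr_eucl_norm x : eucl_norm x ^+ 2 = dot x x.
Proof.
rewrite /eucl_norm sqr_sqrtr; first by apply: eq_bigr => i _; rewrite expr2.
by apply: sumr_ge0 => i _; rewrite sqr_ge0.
Qed.

Lemma eucl_norm_ge0 x : 0 <= eucl_norm x.
Proof. exact: sqrtr_ge0. Qed.

Lemma cauchy_schwarz x y : dot x y <= eucl_norm x * eucl_norm y.
Proof.
have [x0|xN0] := eqVneq (eucl_norm x) 0.
  have /dot_eq0 -> : dot x x = 0 by rewrite -sqr_eucl_norm x0 expr0n.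
  by rewrite dot0l mulr_ge0 ?eucl_norm_ge0.
have xgt0 : 0 < eucl_norm x by rewrite lt_def xN0 eucl_norm_ge0.
rewrite -(ler_pM2l xgt0) -subr_ge0.
have [y0|yN0] := eqVneq (eucl_norm y) 0.
  have /dot_eq0 -> : dot y y = 0 by rewrite -sqr_eucl_norm y0 expr0n.
  by rewrite dot0r mulr0 subr0 !mulr_ge0 ?eucl_norm_ge0.
have ygt0 : 0 < eucl_norm y by rewrite lt_def yN0 eucl_norm_ge0.
rewrite -(pmulr_rge0 _ ygt0).
(* This square expands to [2 * a * b * (a * b - t)], with a, b the norms and t the inner product. *)
have := dot_ge0 (eucl_norm y *: x - eucl_norm x *: y).
rewrite dotDl !dotDr !dotNl !dotNr !dotZl !dotZr -!sqr_eucl_norm (dotC y x).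
rewrite opprK; set a := eucl_norm x; set b := eucl_norm y; set t := dot x y.
by move=> h; lra.
Qed.

Lemma eucl_norm_triangle x y : eucl_norm (x + y) <= eucl_norm x + eucl_norm y.
Proof.
rewrite -(@ler_pXn2r _ 2) ?nnegrE ?addr_ge0 ?eucl_norm_ge0 //.
rewrite sqr_eucl_norm dotDl !dotDr (dotC y x) -!sqr_eucl_norm.
by have := cauchy_schwarz x y; lra.
Qed.

Lemma eucl_norm0 : eucl_norm (0 : 'rV[R]_n) = 0.
Proof.
by apply/eqP; rewrite -sqrf_eq0 sqr_eucl_norm dot0l.
Qed.

Lemma eucl_norm_eq0 x : eucl_norm x = 0 -> x = 0.
Proof. by move=> x0; apply: dot_eq0; rewrite -sqr_eucl_norm x0 expr0n. Qed.

Lemma eucl_normN x : eucl_norm (- x) = eucl_norm x.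
Proof.
apply/eqP; rewrite -(@eqrXn2 _ 2) ?eucl_norm_ge0 //.
by rewrite !sqr_eucl_norm dotNl dotNr opprK.
Qed.

Lemma eucl_normZ a x : eucl_norm (a *: x) = `|a| * eucl_norm x.
Proof.
apply/eqP; rewrite -(@eqrXn2 _ 2) ?mulr_ge0 ?eucl_norm_ge0 //.
by rewrite exprMn !sqr_eucl_norm dotZl dotZr mulrA -expr2 real_normK ?num_real.
Qed.

Lemma coord_le_eucl_norm x i : `|x 0 i| <= eucl_norm x.
Proof.
rewrite -(@ler_pXn2r _ 2) ?nnegrE ?eucl_norm_ge0 //.
rewrite sqr_eucl_norm real_normK ?num_real // /dot (bigD1 i) //= expr2 lerDl.
by apply: sumr_ge0 => j _; rewrite -expr2 sqr_ge0.
Qed.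

Lemma eucl_norm_le_sum x : eucl_norm x <= \sum_(i < n) `|x 0 i|.
Proof.
have -> : x = \sum_(i < n) x 0 i *: delta_mx 0 i by rewrite -row_sum_delta.
apply: (@le_trans _ _ (\sum_(i < n) eucl_norm (x 0 i *: delta_mx 0 i))).
  elim/big_ind2: _ => [|a b c d ab cd|//]; first by rewrite eucl_norm0.
  by rewrite (le_trans (eucl_norm_triangle _ _)) ?lerD.
rewrite -row_sum_delta; apply: ler_sum => i _.
rewrite eucl_normZ -[leRHS]mulr1 ler_wpM2l//.
rewrite -(@ler_pXn2r _ 2) ?nnegrE ?eucl_norm_ge0 //.
rewrite sqr_eucl_norm /dot (bigD1 i) //= big1 ?addr0 ?mxE ?eqxx ?mulr1 ?expr1n //.
by move=> j /negbTE ji; rewrite mxE ji mulr0.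
Qed.

Lemma mx_norm_le_eucl_norm x : `|x| <= eucl_norm x.
Proof.
rewrite /Num.norm /= mx_normrE.
apply: bigmax_le => [|[i j] _ /=]; first exact: eucl_norm_ge0.
by rewrite ord1 coord_le_eucl_norm.
Qed.

Lemma coord_le_mx_norm x i : `|x 0 i| <= `|x|.
Proof.
rewrite [leRHS]/Num.norm /= mx_normrE.
exact: (le_bigmax_cond _ (fun ij => `|x ij.1 ij.2|) (j := (0, i))).
Qed.

Lemma eucl_norm_le_mx_norm x : eucl_norm x <= n%:R * `|x|.
Proof.
rewrite (le_trans (eucl_norm_le_sum _)) // -[n in n%:R]card_ord mulr_natl.
by rewrite -sumr_const; apply: ler_sum => i _; exact: coord_le_mx_norm.
Qed.

Lemma eucl_dist_ge0 x y : 0 <= eucl_dist x y.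
Proof. exact: eucl_norm_ge0. Qed.

Lemma eucl_distC x y : eucl_dist x y = eucl_dist y x.
Proof. by rewrite /eucl_dist -opprB eucl_normN. Qed.

Lemma eucl_distxx x : eucl_dist x x = 0.
Proof. by rewrite /eucl_dist subrr eucl_norm0. Qed.

Lemma eucl_dist_triangle y x z : eucl_dist x z <= eucl_dist x y + eucl_dist y z.
Proof.
rewrite /eucl_dist -[x - z](_ : x - y + (y - z) = _) ?eucl_norm_triangle //.
by rewrite addrA subrK.
Qed.

Lemma eucl_dist_eq0 x y : eucl_dist x y = 0 -> x = y.
Proof. by move=> /eucl_norm_eq0 /eqP; rewrite subr_eq0 => /eqP. Qed.

Lemma eucl_dist_gt0 x y : x <> y -> 0 < eucl_dist x y.
Proof.
move=> xy; rewrite lt_def eucl_dist_ge0 andbT; apply/eqP.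
by move=> /eucl_dist_eq0.
Qed.

End Euclid.

(** * Hausdorff measure and finite covers *)

Section HausdorffContent.
Context {R : realType} {n : nat}.
Implicit Types (s t r d h : R) (U A K : set 'rV[R]_n).

(** Real-valued form of the bound [diam U <= r], which keeps extended reals out of the covering
    arguments. *)
Definition small U r := forall x y, U x -> U y -> eucl_dist x y <= r.

Lemma subset_small U V r : U `<=` V -> small V r -> small U r.
Proof. by move=> UV Vr x y /UV Vx /UV Vy; exact: Vr. Qed.

Lemma le_small U r r' : r <= r' -> small U r -> small U r'.
Proof. by move=> rr' Ur x y Ux Uy; exact: le_trans (Ur x y Ux Uy) rr'. Qed.

Lemma small_eucl_cball x r : small (eucl_cball x r) (2 * r).
Proof.
move=> y z xy xz; apply: le_trans (eucl_dist_triangle x y z) _.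
by rewrite eucl_distC mulr_natl mulr2n lerD.
Qed.

Lemma diam_ge0 U : (0 <= diam U)%E.
Proof. by apply: ereal_sup_ubound; left. Qed.

Lemma small_diam U r : 0 <= r -> small U r -> (diam U <= r%:E)%E.
Proof.
move=> r0 Ur; apply: ge_ereal_sup => _ [->|[x Ux] [y Uy] <-]; rewrite lee_fin//.
exact: Ur.
Qed.

Lemma diam_small U r : (diam U <= r%:E)%E -> small U r.
Proof.
move=> Ur x y Ux Uy; rewrite -lee_fin; apply: le_trans Ur.
by apply: ereal_sup_ubound; right; exists x => //; exists y.
Qed.

Lemma gauge_ge0 s U : (0 <= gauge s U)%E.
Proof. by rewrite /gauge; case: ifP => // _; exact: poweR_ge0. Qed.

Lemma gauge0 s : gauge s (set0 : set 'rV[R]_n) = 0%E.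
Proof. by rewrite /gauge eqxx. Qed.

Lemma gauge_le s U r : 0 <= s -> 0 <= r -> small U r ->
  (gauge s U <= (r `^ s)%:E)%E.
Proof.
move=> s0 r0 Ur; rewrite /gauge; case: ifP => _.
  by rewrite lee_fin powR_ge0.
rewrite -poweR_EFin; apply: gt0_ler_poweR => //; last exact: small_diam.
- by rewrite in_itv /= diam_ge0 leey.
- by rewrite in_itv /= lee_fin r0 leey.
Qed.

Lemma hausdorff_premeasure_ge0 s d A : (0 <= hausdorff_premeasure s d A)%E.
Proof.
apply: le_ereal_inf_tmp => _ [U _ <-]; apply: nneseries_ge0 => k _ _.
exact: gauge_ge0.
Qed.

Lemma premeasure_le_measure s d A : 0 < d ->
  (hausdorff_premeasure s d A <= hausdorff_measure s A)%E.
Proof. by move=> d0; apply: ereal_sup_ubound; exists d. Qed.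

Lemma hausdorff_measure_ge0 s A : (0 <= hausdorff_measure s A)%E.
Proof.
exact: le_trans (hausdorff_premeasure_ge0 s 1 A) (premeasure_le_measure _ _ _).
Qed.

Lemma premeasure_anti s d d' A : d <= d' ->
  (hausdorff_premeasure s d' A <= hausdorff_premeasure s d A)%E.
Proof.
move=> dd'; apply: ereal_inf_le_tmp => _ [U [AU Ud] <-]; exists U => //; split=> //.
by move=> k; apply: le_trans (Ud k) _; rewrite lee_fin.
Qed.

Lemma le_hausdorff_measure s A B : A `<=` B ->
  (hausdorff_measure s A <= hausdorff_measure s B)%E.
Proof.
move=> AB; apply: ge_ereal_sup => _ [d d0 <-].
apply: le_trans (premeasure_le_measure _ _ d0).
apply: ereal_inf_le_tmp => _ [U [BU Ud] <-]; exists U => //; split=> //.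
exact: subset_trans BU.
Qed.

(** Padding with [set0] turns the finite family into a sequence; by the convention on [gauge] this
    costs nothing, even for s = 0. *)
Lemma premeasure_le_finite (T : eqType) (J : seq T) (U : T -> set 'rV[R]_n)
    (r : T -> R) s d A : 0 <= s -> 0 <= d ->
    (forall j, j \in J -> 0 <= r j <= d) -> (forall j, small (U j) (r j)) ->
    (forall x, A x -> exists2 j, j \in J & U j x) ->
  (hausdorff_premeasure s d A <= (\sum_(j <- J) r j `^ s)%:E)%E.
Proof.
move=> s0 d0 rd Ur AU; pose V k := nth set0 (map U J) k.
have VU k : (k < size J)%N -> exists2 j, j \in J & V k = U j.
  case: J {rd AU} @V => // j0 J V kJ; exists (nth j0 (j0 :: J) k).
    exact: mem_nth.
  by rewrite /V (nth_map j0).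
apply: (@le_trans _ _ (\sum_(0 <= k <oo) gauge s (V k))%E).
  apply: ereal_inf_lbound; exists V => //; split.
    move=> x /AU[j jJ Ujx]; exists (index j J) => //.
    by rewrite /V (nth_map j) ?index_mem ?nth_index.
  move=> k; have [/VU[j jJ ->]|kJ] := ltnP k (size J).
    have /andP[r0 rd'] := rd j jJ.
    by apply: small_diam => //; apply: le_small rd' _.
  by rewrite /V nth_default ?size_map//; apply: small_diam.
rewrite (nneseries_split 0 (size J)); last by move=> k _; exact: gauge_ge0.
rewrite add0n [X in (_ + X)%E]eseries0 ?adde0; last first.
  by move=> k kJ _; rewrite /V nth_default ?size_map// gauge0.
rewrite -(size_map U) -(big_nth set0 xpredT (gauge s)) big_map -sumEFin.
rewrite big_seq [leRHS]big_seq; apply: lee_sum => j jJ.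
by have /andP[r0 _] := rd j jJ; exact: gauge_le.
Qed.

(** A lower bound for Hausdorff content, tested on finite covers with positive size bounds, so that
    induction on the length of a cover is possible. *)
Definition finite_content_ge K t h := forall (J : seq nat)
    (U : nat -> set 'rV[R]_n) (r : nat -> R),
  (forall j, 0 < r j) -> (forall j, small (U j) (r j)) ->
  (forall x, K x -> exists2 j, j \in J & U j x) -> h <= \sum_(j <- J) r j `^ t.

Lemma powR_increase (t d e : R) : 0 <= t -> 0 <= d -> 0 < e ->
  exists2 eta, 0 < eta & (d + eta) `^ t <= d `^ t + e.
Proof.
rewrite le_eqVlt => /predU1P[<- _ e0|t0 d0 e0].
  by exists 1 => //; rewrite !powRr0 lerDl ltW.
have de : 0 < d `^ t + e by rewrite ltr_wpDl ?powR_ge0.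
exists ((d `^ t + e) `^ t^-1 - d).
  rewrite subr_gt0 -[ltLHS](@powRr1 _ d)// -(@mulfV _ t) ?gt_eqF// powRrM.
  by apply: gt0_ltr_powR; rewrite ?invr_gt0 ?nnegrE ?powR_ge0 ?ltW// ltrDl.
by rewrite addrC subrK -powRrM mulVf ?gt_eqF// powRr1 // ltW.
Qed.

Lemma open_eucl_ball (x : 'rV[R]_n) r : open [set y | eucl_dist x y < r].
Proof.
rewrite openE => y /= xy; apply/nbhs_ballP.
(* The Euclidean norm is at most n times the maximum norm; [n.+1] keeps the divisor nonzero for n =
   0. *)
have e0 : 0 < (r - eucl_dist x y) / n.+1%:R by rewrite divr_gt0// subr_gt0.
exists ((r - eucl_dist x y) / n.+1%:R) => //= z.
rewrite -ball_normE /= ltr_pdivlMr// => yz.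
apply: le_lt_trans (eucl_dist_triangle y x z) _; rewrite -ltrBrDl.
apply: le_lt_trans yz; rewrite mulrC; apply: le_trans (eucl_norm_le_mx_norm _) _.
by rewrite ler_wpM2r// ler_nat.
Qed.

Lemma closed_eucl_cball (x : 'rV[R]_n) r : closed (eucl_cball x r).
Proof.
rewrite -[eucl_cball x r]setCK closedC.
suff -> : ~` eucl_cball x r = \bigcup_(y in ~` eucl_cball x r)
    [set z | eucl_dist y z < eucl_dist x y - r].
  by apply: bigcup_open => y _; exact: open_eucl_ball.
apply/seteqP; split=> [y xy|z [y _ /= yz]].
  exists y => //=; rewrite eucl_distxx subr_gt0 ltNge; exact/negP.
apply/negP; rewrite -ltNge; have := eucl_dist_triangle z x y.
by move: yz; rewrite (eucl_distC z y); lra.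
Qed.

Lemma lee_sum_nneseries (a : nat -> \bar R) (J : seq nat) : uniq J ->
    (forall k, 0 <= a k)%E ->
  (\sum_(j <- J) a j <= \sum_(0 <= k <oo) a k)%E.
Proof.
move=> uJ a0; pose N := (\max_(j <- J) j).+1.
apply: (le_trans _ (nneseries_lim_ge N (fun k _ _ => a0 k))).
rewrite [leRHS](bigID (mem J))/=.
apply: lee_paddr; first by apply: sume_ge0.
rewrite -[leRHS]big_filter le_eqVlt; apply/orP; left; apply/eqP.
apply: perm_big; apply: uniq_perm => //; first by rewrite filter_uniq ?iota_uniq.
move=> j; rewrite mem_filter mem_index_iota/=.
by case jJ : (j \in J) => //=; rewrite ltnS (@leq_bigmax_seq _ J xpredT (fun i => i)).
Qed.

(** Compactness reduces countable covers to finite ones, once the sets are enlarged to open ones at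
    total cost e. *)
Lemma finite_content_le_measure K t h : compact K -> 0 <= t ->
  finite_content_ge K t h -> (h%:E <= hausdorff_measure t K)%E.
Proof.
move=> cK t0 Kh; apply: (@le_trans _ _ (hausdorff_premeasure t 1 K)); last first.
  exact: premeasure_le_measure.
apply: le_ereal_inf_tmp => _ [U [KU Ud] <-].
apply/lee_addgt0Pr => e e0.
have dU k : diam (U k) = (fine (diam (U k)))%:E.
  by rewrite fineK// ge0_fin_numE ?diam_ge0//; exact: le_lt_trans (Ud k) (ltry _).
have d0 k : 0 <= fine (diam (U k)) by rewrite -lee_fin -dU diam_ge0.
have ek0 k : 0 < e / (2 ^ k.+1)%:R by rewrite divr_gt0// ltr0n expn_gt0.
have /choice[eta etaP] k : exists eta, 0 < eta /\
    (fine (diam (U k)) + eta) `^ t <= fine (diam (U k)) `^ t + e / (2 ^ k.+1)%:R.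
  by have [eta] := powR_increase t0 (d0 k) (ek0 k); exists eta.
have eta0 k : 0 < eta k by have [] := etaP k.
pose V k := \bigcup_(x in U k) [set y | eucl_dist x y < eta k / 2].
have openV k : setT k -> open (V k).
  by move=> _; apply: bigcup_open => x _; exact: open_eucl_ball.
have KV : K `<=` cover setT V.
  move=> x /KU[k _ Ukx]; exists k => //; exists x => //=.
  by rewrite eucl_distxx divr_gt0.
have smallV k : small (V k) (fine (diam (U k)) + eta k).
  move=> x y [x' Ux' x'x] [y' Uy' y'y].
  apply: le_trans (eucl_dist_triangle x' x y) _.
  apply: (le_trans (lerD (lexx _) (eucl_dist_triangle y' x' y))).
  have := diam_small (eq_ind_r (fun z => z <= _)%E (lexx _) (dU k)) Ux' Uy'.
  by rewrite (eucl_distC x x'); move: x'x y'y => /=; lra.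
move: cK; rewrite compact_cover => /(_ _ _ _ openV KV)[D _ KD].
(* Empty sets must be dropped: their gauge is 0, while the power of their radius is 1 when t = 0. *)
pose J := [seq k <- enum_fset D | U k != set0].
have uJ : uniq J by rewrite filter_uniq ?fset_uniq.
have KJ x : K x -> exists2 j, j \in J & V j x.
  move=> /KD[k /= kD Vkx]; exists k => //; rewrite mem_filter kD andbT.
  by case: Vkx => y Uky _; apply/set0P; exists y.
have := Kh J V _ (fun k => ltr_wpDl (d0 k) (eta0 k)) smallV KJ.
rewrite -lee_fin => /le_trans; apply.
apply: le_trans (epsilon_trick xpredT (fun k => gauge_ge0 t (U k)) (ltW e0)).
apply: le_trans (lee_sum_nneseries uJ _); last first.
  by move=> k; rewrite adde_ge0 ?gauge_ge0// lee_fin ltW.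
rewrite -sumEFin big_seq [leRHS]big_seq; apply: lee_sum => k.
rewrite mem_filter => /andP[/negbTE Uk _].
have [_] := etaP k; rewrite -lee_fin => /le_trans; apply.
by rewrite /gauge Uk EFinD -poweR_EFin -dU.
Qed.

Lemma finite_content_exp0 K : K !=set0 -> finite_content_ge K 0 1.
Proof.
move=> [x Kx] J U r r0 Ur /(_ x Kx)[j jJ _].
by rewrite (big_rem j)//= powRr0 lerDl sumr_ge0// => i _; exact: powR_ge0.
Qed.

(** For s > 0, a finite cover with sum below d^s has all radii below d; hence covers with
    arbitrarily small sums would make every premeasure vanish. *)
Lemma measure_gt0_finite_content K s : 0 <= s -> K !=set0 ->
  (0 < hausdorff_measure s K)%E -> exists2 h, 0 < h & finite_content_ge K s h.
Proof.
rewrite le_eqVlt => /predU1P[<- K0 _|s0 _].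
  by exists 1 => //; exact: finite_content_exp0.
apply: contraPP => /forall2NP noh; rewrite lt_neqAle hausdorff_measure_ge0 andbT.
apply/negP; rewrite negbK; apply/eqP/esym/eqP; rewrite eq_le hausdorff_measure_ge0 andbT.
apply: ge_ereal_sup => _ [d d0 <-]; apply/lee_addgt0Pr => e e0; rewrite add0e.
have h0 : 0 < Num.min e (d `^ s) by rewrite lt_min e0 powR_gt0.
have [/negP//|/existsNP[J /existsNP[U /existsNP[r]]]] := noh (Num.min e (d `^ s)).
move=> /not_implyP[r0 /not_implyP[Ur /not_implyP[KU /negP]]].
rewrite -ltNge lt_min => /andP[re rd].
apply: (@le_trans _ _ (\sum_(j <- J) r j `^ s)%:E); last by rewrite lee_fin ltW.
apply: premeasure_le_finite Ur KU => //; [exact: ltW|exact: ltW|move=> j jJ].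
rewrite (ltW (r0 j))/= leNgt; apply/negP => drj.
move: rd; rewrite ltNge => /negP; apply.
apply: (@le_trans _ _ (r j `^ s)).
  by apply: ge0_ler_powR; rewrite ?nnegrE ?ltW.
by rewrite (big_rem j)//= lerDl sumr_ge0// => i _; exact: powR_ge0.
Qed.

(** On sets of diameter at most 1 the gauge does not increase with the exponent. *)
Lemma measure_eq0_gt K s t : 0 <= s -> s < t -> hausdorff_measure s K = 0%E ->
  hausdorff_measure t K = 0%E.
Proof.
move=> s0 st K0; apply/eqP; rewrite eq_le hausdorff_measure_ge0 andbT.
apply: ge_ereal_sup => _ [d d0 <-].
have d1 : 0 < Num.min d 1 by rewrite lt_min d0 ltr01.
rewrite -K0; apply: le_trans (premeasure_le_measure s K d1).
apply: le_trans (premeasure_anti _ _ (_ : Num.min d 1 <= d)) _.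
  by rewrite ge_min lexx.
apply: le_ereal_inf_tmp => _ [U [KU Ud] <-]; apply: ge_ereal_inf.
exists (\sum_(0 <= k <oo) gauge t (U k))%E; first by exists U.
apply: lee_nneseries => [k _ _|k _]; first exact: gauge_ge0.
rewrite /gauge; case: ifPn => // Uk.
have dU : diam (U k) = (fine (diam (U k)))%:E.
  by rewrite fineK// ge0_fin_numE ?diam_ge0//; exact: le_lt_trans (Ud k) (ltry _).
have := Ud k; have := diam_ge0 (U k).
rewrite dU !poweR_EFin !lee_fin le_min => + /andP[_].
rewrite le_eqVlt => /predU1P[<- _|dk0 dk1].
  by rewrite powR0 ?gt_eqF ?powR_ge0// (le_lt_trans s0).
by apply: ger_powR (ltW st); rewrite dk0.
Qed.

Lemma hausdorff_dim_le K s t : hausdorff_dim K = s%:E -> 0 <= t ->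
  hausdorff_measure t K = 0%E -> s <= t.
Proof.
by move=> Ks t0 Kt; rewrite -lee_fin -Ks; apply: ereal_inf_lbound; exists t.
Qed.

Lemma hausdorff_dim_ge0 K s : hausdorff_dim K = s%:E -> 0 <= s.
Proof.
move=> Ks; rewrite -lee_fin -Ks; apply: le_ereal_inf_tmp => _ [t [t0 _] <-].
by rewrite lee_fin.
Qed.

Lemma finite_content_le_dim K s t h : compact K -> hausdorff_dim K = s%:E ->
  0 < h -> finite_content_ge K t h -> t <= s.
Proof.
move=> cK Ks h0 Kh; rewrite leNgt; apply/negP => st.
have := st; rewrite -lte_fin -Ks => /ereal_inf_lt[_ [u [u0 Ku] <-]].
rewrite lte_fin => ut.
have := finite_content_le_measure cK (le_trans u0 (ltW ut)) Kh.
by rewrite (measure_eq0_gt u0 ut Ku) lee_fin leNgt h0.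
Qed.

Lemma finite_content_seq (T : eqType) (J : seq T) (U : T -> set 'rV[R]_n)
    (r : T -> R) K t h : finite_content_ge K t h ->
    (forall j, 0 < r j) -> (forall j, small (U j) (r j)) ->
    (forall x, K x -> exists2 j, j \in J & U j x) ->
  h <= \sum_(j <- J) r j `^ t.
Proof.
move=> Kh r0 Ur KU.
have := Kh (iota 0 (size J)) (nth set0 (map U J)) (nth 1 (map r J)).
rewrite -(size_map r J) -{2}(subn0 (size (map r J))) -/(index_iota _ _).
rewrite -(big_nth 1 xpredT (fun y => y `^ t)) big_map; apply.
- move=> k; have [kJ|kJ] := ltnP k (size J); last first.
    by rewrite nth_default ?size_map.
  by case: J kJ {KU} => // j0 J kJ; rewrite (nth_map j0).
- move=> k; have [kJ|kJ] := ltnP k (size J); last first.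
    by rewrite nth_default ?size_map.
  by case: J kJ {KU} => // j0 J kJ; rewrite !(nth_map j0).
- move=> x /KU[j jJ Ujx]; exists (index j J).
    by rewrite mem_iota /= size_map index_mem.
  by rewrite (nth_map j) ?index_mem ?nth_index.
Qed.

End HausdorffContent.

(** * Finite covers and separated nets *)

Section FiniteCovers.
Context {R : realType} {n : nat}.
Implicit Types (r : R) (m : nat) (A B : set 'rV[R]_n).

(** The sets may be empty or repeat, so m is only an upper bound for the covering number at scale
    r. *)
Definition coverable_by A r m := exists U : 'I_m -> set 'rV[R]_n,
  A `<=` \bigcup_i U i /\ forall i, small (U i) r.

Lemma coverableS A B r m : A `<=` B -> coverable_by B r m -> coverable_by A r m.
Proof. by move=> AB [U [BU Ur]]; exists U; split=> //; exact: subset_trans BU. Qed.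

Lemma coverable_le_scale A r r' m : r <= r' -> coverable_by A r m -> coverable_by A r' m.
Proof.
by move=> rr' [U [AU Ur]]; exists U; split=> // i; exact: le_small rr' (Ur i).
Qed.

Lemma coverable_small A r : small A r -> coverable_by A r 1.
Proof. by move=> Ar; exists (fun=> A); split=> // x Ax; exists ord0. Qed.

Lemma coverable0 r m : coverable_by set0 r m.
Proof. by exists (fun=> set0); split=> [x []|i x y []]. Qed.

Lemma coverableU A B r m k : coverable_by A r m -> coverable_by B r k ->
  coverable_by (A `|` B) r (m + k).
Proof.
move=> [U [AU Ur]] [V [BV Vr]].
exists (fun i => match fintype.split i with inl a => U a | inr b => V b end); split.
  move=> x [/AU[i _ Uix]|/BV[i _ Vix]].
    by exists (unsplit (inl i)) => //; rewrite unsplitK.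
  by exists (unsplit (inr i)) => //; rewrite unsplitK.
by move=> i; case: (fintype.split i).
Qed.

Lemma coverable_leq A r m k : (m <= k)%N -> coverable_by A r m -> coverable_by A r k.
Proof.
move=> mk Am; rewrite -(subnKC mk) -[A]setU0.
by apply: coverableU => //; exact: coverable0.
Qed.

Lemma coverable_bigcup (T : eqType) (J : seq T) (B : T -> set 'rV[R]_n)
    (m : T -> nat) A r :
    (forall x, A x -> exists2 j, j \in J & B j x) ->
    (forall j, j \in J -> coverable_by (B j) r (m j)) ->
  coverable_by A r (\sum_(j <- J) m j).
Proof.
elim: J A => [|a J IH] A AB Bm.
  rewrite big_nil; apply: coverableS (coverable0 r 0) => x /AB[].
  by move=> j; rewrite in_nil.
rewrite big_cons.
apply: (@coverableS _ (B a `|` (A `\` B a))).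
  by move=> x Ax; have [Bax|nBax] := pselect (B a x); [left|right].
apply: coverableU; first by apply: Bm; rewrite inE eqxx.
apply: IH => [x [/AB[j]]|j jJ]; last by apply: Bm; rewrite inE jJ orbT.
by rewrite inE => /predU1P[->//|jJ Bjx _]; exists j.
Qed.

Lemma coverable_image A r m (f : 'rV[R]_n -> 'rV[R]_n) a : 0 <= a ->
    (forall x y, eucl_dist (f x) (f y) = a * eucl_dist x y) ->
  coverable_by A r m -> coverable_by (f @` A) (a * r) m.
Proof.
move=> a0 fa [U [AU Ur]]; exists (fun i => f @` U i); split.
  by move=> _ [x /AU[i _ Uix] <-]; exists i => //; exists x.
move=> i _ _ [x Ux <-] [y Uy <-]; rewrite fa ler_wpM2l//; exact: (Ur i).
Qed.

Lemma coverable_covered A r b : coverable A r b ->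
  exists2 m, coverable_by A r m & m%:R <= b.
Proof.
move=> [m [U [mb AU Ur]]]; exists m => //; exists U; split=> // i.
exact: diam_small.
Qed.

Lemma covered_coverable A r b m : 0 <= r -> coverable_by A r m -> m%:R <= b ->
  coverable A r b.
Proof.
move=> r0 [U [AU Ur]] mb; exists m, U; split=> // i; exact: small_diam.
Qed.

Lemma measure_le_covered A (s c : R) : 0 <= s ->
    (forall d, 0 < d -> exists r m,
      [/\ 0 < r <= d, coverable_by A r m & m%:R * r `^ s <= c]) ->
  (hausdorff_measure s A <= c%:E)%E.
Proof.
move=> s0 Ac; apply: ge_ereal_sup => _ [d /= d0 <-].
have [r [m [/andP[r0 rd] [U [AU Ur]] mc]]] := Ac d d0.
apply: (@le_trans _ _ (\sum_(i <- enum 'I_m) r `^ s)%:E).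
  apply: (premeasure_le_finite (U := U) (r := fun=> r)) => //; first exact: ltW.
    by move=> i _; rewrite ltW.
  by move=> x /AU[i _ Uix]; exists i; rewrite ?mem_enum.
by rewrite lee_fin big_enum /= sumr_const card_ord -mulr_natl.
Qed.

Lemma coverable_gt0 A r m : A !=set0 -> coverable_by A r m -> (0 < m)%N.
Proof. by case: m => // -[x Ax] [U [/(_ x Ax)[[]]]]. Qed.

(** Greedy choice, by induction on the size of a cover: the r-ball about a point of the first set
    contains the part of [A] in that set, and the rest needs one set less. *)
Lemma separated_net A r m : coverable_by A r m ->
  exists Y : seq 'rV[R]_n, [/\ uniq Y, forall y, y \in Y -> A y,
    forall y y', y \in Y -> y' \in Y -> y != y' -> r < eucl_dist y y' &
    forall x, A x -> exists2 y, y \in Y & eucl_dist x y <= r].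
Proof.
elim: m A => [|m IH] A [U [AU Ur]].
  by exists [::]; split=> // x /AU[[]].
have [[y [Ay Uy]]|noy] := pselect (exists y, A y /\ U ord0 y); last first.
  apply: IH; exists (fun i => U (lift ord0 i)); split=> // x Ax.
  have [i _ Uix] := AU x Ax; case: (unliftP ord0 i) Uix => [j -> Ux|-> Ux].
    by exists j.
  by case: noy; exists x.
have [|Y [uY YA Yr AY]] := IH (A `\` [set x | eucl_dist x y <= r]).
  exists (fun i => U (lift ord0 i)); split=> // x [Ax xy].
  have [i _ Uix] := AU x Ax; case: (unliftP ord0 i) Uix => [j -> Ux|-> Ux].
    by exists j.
  by case: xy; exact: (Ur ord0).
have far y' : y' \in Y -> r < eucl_dist y' y.
  by move=> /YA[_] /= /negP; rewrite -ltNge.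
have yY : y \notin Y.
  apply/negP => /YA[_] /=; apply; rewrite eucl_distxx.
  by rewrite -(eucl_distxx y); exact: (Ur ord0).
exists (y :: Y); split=> /=.
- by rewrite yY.
- by move=> y'; rewrite inE => /predU1P[->//|/YA[]].
- move=> y1 y2; rewrite !inE => /predU1P[->|y1Y] /predU1P[->|y2Y] //.
  + by rewrite eqxx.
  + by rewrite eucl_distC => _; exact: far.
  + by move=> _; exact: far.
  + exact: Yr.
- move=> x Ax; have [xy|xy] := leP (eucl_dist x y) r.
    by exists y => //; rewrite inE eqxx.
  have [|y' y'Y xy'] := AY x; first by split=> //=; apply/negP; rewrite -ltNge.
  by exists y' => //; rewrite inE y'Y orbT.
Qed.

End FiniteCovers.

(** * Bounds on finite families and on real powers *)

Section FiniteBounds.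
Context {R : realType}.

Lemma pos_lower_bound (T : eqType) (J : seq T) (a : T -> R) :
  (forall j, j \in J -> 0 < a j) -> exists2 e, 0 < e & forall j, j \in J -> e <= a j.
Proof.
elim: J => [|j J IH] a0; first by exists 1.
have [|e e0 ea] := IH; first by move=> i iJ; apply: a0; rewrite inE iJ orbT.
exists (Num.min e (a j)); first by rewrite lt_min e0 a0// inE eqxx.
move=> i; rewrite inE ge_min => /predU1P[->|/ea ->//].
by rewrite lexx orbT.
Qed.

(** A small change of exponent costs at most a prescribed factor q, as e^tau tends to 1 when tau
    decreases to 0; ln q / - ln e is the exponent at which the cost is exactly q. *)
Lemma powR_near1 (e q b : R) : 0 < e < 1 -> 1 < q -> 0 < b ->
  exists tau, 0 < tau <= b /\ q^-1 <= e `^ tau.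
Proof.
move=> /andP[e0 e1] q1 b0; have lne : ln e < 0 by rewrite ln_lt0// e0.
have tau0 : 0 < ln q / - ln e by rewrite divr_gt0 ?oppr_gt0// ln_gt0.
exists (Num.min b (ln q / - ln e)); split.
  by rewrite lt_min b0 tau0 ge_min lexx.
apply: (@le_trans _ _ (e `^ (ln q / - ln e))); last first.
  by apply: ger_powR; [rewrite e0 ltW|rewrite ge_min lexx orbT].
rewrite /powR gt_eqF// invrN mulrN mulNr -mulrA mulVf ?lt_eqF// mulr1.
by rewrite expRN lnK// posrE (lt_trans ltr01).
Qed.

(** At most one term survives; this serves for a small set of a cover, which meets at most one of
    several separated pieces. *)
Lemma sumr_filter_le1 (T : eqType) (J : seq T) (P : pred T) (x : R) : 0 <= x ->
    uniq J -> (forall u v, u \in J -> v \in J -> P u -> P v -> u = v) ->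
  \sum_(w <- J | P w) x <= x.
Proof.
move=> x0 uJ P1; rewrite -big_filter.
have : uniq (seq.filter P J) by rewrite filter_uniq.
have : forall u v, u \in seq.filter P J -> v \in seq.filter P J -> u = v.
  by move=> u v; rewrite !mem_filter => /andP[Pu uu] /andP[Pv vv]; exact: P1.
case: (seq.filter P J) => [|u [|v l]] Juv; rewrite ?big_nil ?big_seq1//=.
by rewrite (Juv u v) ?inE ?eqxx ?orbT.
Qed.

Lemma powR_div (a b t : R) : 0 <= a -> 0 < b -> (a / b) `^ t = a `^ t / b `^ t.
Proof.
move=> a0 b0; have bt0 : b `^ t != 0 by rewrite gt_eqF ?powR_gt0.
apply: (mulIf bt0); rewrite divfK// -powRM ?divfK ?gt_eqF//; last exact: ltW.
by rewrite divr_ge0// ltW.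
Qed.

Lemma powR_inv (a t : R) : 0 < a -> a^-1 `^ t = (a `^ t)^-1.
Proof. by move=> a0; rewrite -div1r powR_div// powR1 div1r. Qed.

Lemma powR_small (t e : R) : 0 < t -> 0 < e ->
  exists2 d0, 0 < d0 & forall d, 0 <= d <= d0 -> d `^ t <= e.
Proof.
move=> t0 e0; exists (e `^ t^-1); first exact: powR_gt0.
move=> d /andP[d0 dd].
have -> : e = (e `^ t^-1) `^ t by rewrite -powRrM mulVf ?gt_eqF// powRr1// ltW.
by apply: ge0_ler_powR; rewrite ?nnegrE ?powR_ge0// ltW.
Qed.

End FiniteBounds.

(** * Similarities are affine *)

Section Affine.
Context {R : realType} {n : nat}.
Implicit Types (x y : 'rV[R]_n) (f : 'rV[R]_n -> 'rV[R]_n).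

Definition affine f := exists (A : 'M[R]_n) b, forall x, f x = x *m A + b.

(* Distances determine inner products, hence [f - f 0] is additive and
   homogeneous. *)
Lemma similarity_affine f c : (forall x y, eucl_dist (f x) (f y) = c * eucl_dist x y) ->
  affine f.
Proof.
move=> fc; have [g gE] : exists g, forall x, g x = f x - f 0.
  by exists (fun x => f x - f 0).
have gB x y : g x - g y = f x - f y by rewrite !gE opprB addrA subrK.
have g0 : g 0 = 0 by rewrite gE subrr.
have gsqr x y : dot (g x - g y) (g x - g y) = c ^+ 2 * dot (x - y) (x - y).
  by rewrite gB -!sqr_eucl_norm -exprMn -/(eucl_dist (f x) (f y)) fc.
have gdot x y : dot (g x) (g y) = c ^+ 2 * dot x y.
  have := gsqr x y; have := gsqr x 0; have := gsqr y 0; rewrite g0 !subr0.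
  by rewrite !dotDl !dotDr !dotNl !dotNr (dotC (g y) (g x)) (dotC y x); lra.
have glin a x y : g (a *: x + y) = a *: g x + g y.
  apply/eqP; rewrite -subr_eq0; apply/eqP/dot_eq0.
  rewrite opprD !(dotDl, dotDr, dotNl, dotNr, dotZl, dotZr) !gdot.
  rewrite !(dotDl, dotDr, dotNl, dotNr, dotZl, dotZr) (dotC y).
  by ring.
exists (\matrix_(i < n) g (delta_mx 0 i)), (f 0) => x.
have -> : f x = g x + f 0 by rewrite gE subrK.
rewrite mulmx_sum_row; congr (_ + _).
rewrite {1}[x]row_sum_delta.
elim/big_ind2: _ => [//|x1 x2 y1 y2 h1 h2|i _].
  by rewrite -[x2]scale1r glin scale1r h1 h2.
by rewrite -[_ *: _]addr0 glin g0 addr0 rowK.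
Qed.

Lemma similarity_bijective f c : 0 < c ->
    (forall x y, eucl_dist (f x) (f y) = c * eucl_dist x y) ->
  exists h, cancel f h /\ cancel h f.
Proof.
move=> c0 fc; have [A [b fA]] := similarity_affine fc.
have Aunit : A \in unitmx.
  rewrite -row_free_unit; apply: inj_row_free => v vA.
  have /eqP : c * eucl_dist v 0 = 0.
    by rewrite -fc !fA vA mul0mx eucl_distxx.
  by rewrite mulf_eq0 gt_eqF//= => /eqP/eucl_dist_eq0.
exists (fun y => (y - b) *m invmx A); split=> x.
  by rewrite fA addrK mulmxK.
by rewrite fA mulmxKV// subrK.
Qed.

Lemma sub_id_affine f : affine f -> affine (fun x => f x - x).
Proof.
move=> [A [b fA]]; exists (A - 1%:M), b => x.
by rewrite fA mulmxBr mulmx1 addrAC.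
Qed.

Lemma sub_affine f g : affine f -> affine g -> affine (fun x => f x - g x).
Proof.
move=> [A [b fA]] [B [c gB]]; exists (A - B), (b - c) => x.
by rewrite fA gB mulmxBr opprD addrACA.
Qed.

(** * Control of affine maps by finitely many values *)

Lemma affine_coord_bound f (e : R) x : affine f -> eucl_norm (f 0) <= e ->
    (forall i, eucl_norm (f (delta_mx 0 i)) <= e) ->
  eucl_norm (f x) <= e * (1 + 2 * \sum_(i < n) `|x 0 i|).
Proof.
move=> [A [b fA]] f0 fe.
(* The coordinates of x are the coefficients of the differences [f (delta_mx 0 i) - f 0], each of
   norm at most 2 * e. *)
have -> : f x = f 0 + \sum_(i < n) x 0 i *: (f (delta_mx 0 i) - f 0).
  rewrite !fA mul0mx add0r addrC mulmx_sum_row; congr (_ + _).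
  by apply: eq_bigr => i _; rewrite fA addrK rowE.
apply: le_trans (eucl_norm_triangle _ _) _; rewrite mulrDr mulr1; apply: lerD => //.
rewrite mulrA mulr_sumr; elim/big_ind2: _ => [|a b' c d ab cd|i _].
- by rewrite eucl_norm0.
- by apply: le_trans (eucl_norm_triangle _ _) _; exact: lerD.
- rewrite eucl_normZ mulrC ler_wpM2r//.
  apply: le_trans (eucl_norm_triangle _ _) _; rewrite eucl_normN.
  by have := fe i; move: f0; lra.
Qed.

Lemma unit_cube0 : unit_cube (0 : 'rV[R]_n).
Proof. by move=> i; rewrite mxE lexx ler01. Qed.

Lemma unit_cube_delta i : unit_cube (delta_mx 0 i : 'rV[R]_n).
Proof. by move=> j; rewrite mxE eqxx /=; case: eqP; rewrite ?lexx ler01. Qed.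

(** As no hyperplane contains [F], finitely many differences y - y0 of its points span the space,
    and the values at these points control the linear part of an affine map. *)
Lemma affine_frame (F : set 'rV[R]_n) : F !=set0 ->
    ~ (exists2 H : set 'rV[R]_n, affine_hyperplane H & F `<=` H) ->
  exists (Y : seq 'rV[R]_n) (La : R), [/\ Y != [::], forall y, y \in Y -> F y, 0 < La &
    forall f M, affine f -> (forall y, y \in Y -> eucl_norm (f y) <= M) ->
      forall x x', eucl_norm (f x - f x') <= La * M * eucl_dist x x'].
Proof.
move=> [y0 Fy0] nH.
pose P r := exists k (B : 'M[R]_(k, n)),
  (forall i, exists2 y, F y & row i B = y - y0) /\ \rank B = r.
have [r [[k [B [BF Br]]] rmax]] : exists r, P r /\ forall r', P r' -> (r' <= r)%N.
  pose p r := `[< P r >].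
  have p0 : exists r, p r.
    exists 0; apply/asboolP; exists 0, 0; split; first by case.
    by rewrite mxrank0.
  have pn r : p r -> (r <= n)%N.
    by move=> /asboolP[k [B [_ <-]]]; exact: rank_leq_col.
  have [r /asboolP Pr rmax] := ex_maxnP p0 pn.
  by exists r; split=> // r' Pr'; apply: rmax; exact/asboolP.
have Bfull : row_full B.
  rewrite /row_full Br; apply/negPn/negP => rn.
  have rltn : (r < n)%N by rewrite ltn_neqAle rn -Br rank_leq_col.
  (* A nonzero vector orthogonal to all rows of [B]; a point of [F] off the corresponding hyperplane
     through y0 would give a difference that raises the maximal rank. *)
  have /rowV0Pn[a aB a0] : kermx B^T != 0.
    by rewrite -mxrank_eq0 mxrank_ker mxrank_tr Br subn_eq0 -ltnNge.
  have aB0 : a *m B^T = 0 by apply/sub_kermxP.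
  apply: nH; exists [set x | \sum_(i < n) a 0 i * x 0 i = \sum_(i < n) a 0 i * y0 0 i].
    by exists a, (\sum_(i < n) a 0 i * y0 0 i).
  move=> y Fy /=; apply: contrapT => ay.
  pose B' := col_mx B (y - y0).
  have : P (\rank B').
    exists (k + 1)%N, B'; split=> // i; rewrite -[i]splitK.
    case: (fintype.split i) => j /=; last first.
      by exists y => //; rewrite rowKd; apply/rowP => l; rewrite !mxE ord1.
    by have [z Fz Bz] := BF j; exists z => //; rewrite rowKu.
  move=> /rmax; rewrite -Br leqNgt => /negP; apply.
  have BB' : (B <= B')%MS by rewrite /B' -addsmxE addsmxSl.
  rewrite ltn_neqAle !(mxrank_leqif_sup BB') andbT /B' -addsmxE addsmx_sub submx_refl /=.
  apply/negP => /submxP[c yc]; apply: ay; apply/eqP; rewrite -subr_eq0; apply/eqP.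
  rewrite -sumrB (eq_bigr (fun i => a 0 i * (y - y0)^T i 0)); last first.
    by move=> i _; rewrite !mxE mulrBr.
  transitivity ((a *m (y - y0)^T) 0 0); first by rewrite mxE.
  by rewrite yc trmx_mul mulmxA aB0 mul0mx mxE.
have /row_fullP[C CB] := Bfull.
have /choice[yy yyP] i : exists y, F y /\ row i B = y - y0.
  by have [y] := BF i; exists y.
(* [C] is a left inverse of [B] and gives the coefficients of a vector in terms of the differences;
   the summand 1 keeps the constant positive. *)
exists (y0 :: [seq yy i | i <- enum 'I_k]),
  (1 + 2 * \sum_(i < k) \sum_(j < n) `|C j i|).
have Csum : 0 <= \sum_(i < k) \sum_(j < n) `|C j i|.
  by apply: sumr_ge0 => i _; apply: sumr_ge0.
split=> //.
- move=> y; rewrite inE => /predU1P[->//|/mapP[i _ ->]].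
  by have [] := yyP i.
- by move: Csum; lra.
- move=> f M [A [b fA]] fM x x'.
  have M0 : 0 <= M by apply: le_trans (eucl_norm_ge0 (f y0)) _; rewrite fM// inE eqxx.
  have -> : f x - f x' = \sum_(i < k) ((x - x') *m C) 0 i *: (f (yy i) - f y0).
    rewrite !fA opprD addrACA subrr addr0 -mulmxBl -{1}[A]mul1mx -CB.
    rewrite -(mulmxA C) (mulmxA (x - x')) mulmx_sum_row; apply: eq_bigr => i _; congr (_ *: _).
    rewrite !fA opprD addrACA subrr addr0 -mulmxBl row_mul.
    by have [_ ->] := yyP i.
  apply: (@le_trans _ _ (\sum_(i < k) \sum_(j < n) 2 * M * eucl_dist x x' * `|C j i|)).
    elim/big_ind2: _ => [|a b' c d ab cd|i _]; first by rewrite eucl_norm0.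
      by apply: le_trans (eucl_norm_triangle _ _) _; exact: lerD.
    rewrite eucl_normZ mxE mulrC.
    apply: (@le_trans _ _ (2 * M * `|\sum_(j < n) (x - x') 0 j * C j i|)).
      apply: ler_wpM2r => //; apply: le_trans (eucl_norm_triangle _ _) _.
      rewrite eucl_normN mulr_natl mulr2n lerD ?fM ?inE ?eqxx//.
      by rewrite map_f ?orbT// mem_enum.
    rewrite -mulr_sumr -(mulrA (2 * M)); apply: ler_wpM2l; first exact: mulr_ge0.
    rewrite mulr_sumr.
    apply: le_trans (ler_norm_sum _ _ _) _; apply: ler_sum => j _.
    by rewrite normrM ler_wpM2r// coord_le_eucl_norm.
  rewrite (eq_bigr (fun i => 2 * M * eucl_dist x x' * \sum_(j < n) `|C j i|)); last first.
    by move=> i _; rewrite mulr_sumr.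
  rewrite -mulr_sumr.
  have -> : 2 * M * eucl_dist x x' * (\sum_(i < k) \sum_(j < n) `|C j i|) =
    2 * (\sum_(i < k) \sum_(j < n) `|C j i|) * M * eucl_dist x x' by ring.
  by rewrite !ler_wpM2r ?eucl_dist_ge0// lerDr.
Qed.

(** * Compact sets and uniform convergence on the unit cube *)

Lemma compact_covered (K : set 'rV[R]_n) (r : R) : compact K -> 0 < r ->
  exists m, coverable_by K r m.
Proof.
move=> cK r0; have r20 : 0 < r / 2 by rewrite divr_gt0.
pose V (x : 'rV[R]_n) := [set y | eucl_dist x y < r / 2].
have KV : K `<=` cover setT V.
  by move=> x _; exists x => //=; rewrite /V /= eucl_distxx.
have Vo x : setT x -> open (V x) by move=> _; exact: open_eucl_ball.
move: cK; rewrite compact_cover => /(_ _ _ _ Vo KV)[D _ KD].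
exists (\sum_(x <- enum_fset D) 1)%N; apply: (coverable_bigcup (B := V)).
  by move=> x /KD[y /= yD Vyx]; exists y.
move=> y _; apply: coverable_small; have -> : r = 2 * (r / 2) by field.
apply: subset_small (@small_eucl_cball _ _ y (r / 2)).
by move=> z; rewrite /V /eucl_cball /= => /ltW.
Qed.

Lemma compact_eucl_cball x r : compact (eucl_cball x r).
Proof.
apply: bounded_closed_compact; last exact: closed_eucl_cball.
exists (`|x| + r); split; first exact: num_real.
move=> M xM y xy; apply: le_trans (ltW xM).
rewrite -[y](subrK x) addrC.
apply: le_trans (ler_normD _ _) _; rewrite lerD2l.
by apply: le_trans (mx_norm_le_eucl_norm _) _; rewrite -/(eucl_dist y x) eucl_distC.
Qed.

(** The two norms are comparable, so accumulation in the uniform topology can be tested with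
    Euclidean distances. *)
Lemma near_identityP (Q : set ('rV[R]_n -> 'rV[R]_n)) :
  limit_point (Q : set {uniform` @unit_cube R n -> 'rV[R]_n})
    (id : {uniform` @unit_cube R n -> 'rV[R]_n}) <->
  forall e : R, 0 < e -> exists g, [/\ Q g, g <> id &
    forall y, unit_cube y -> eucl_norm (g y - y) <= e].
Proof.
split=> [Qid e e0|Qid U].
  have e1 : 0 < e / n.+1%:R by rewrite divr_gt0.
  have [|g [gid Qg ge]] := Qid [set g | forall y, unit_cube y ->
      ball (y : 'rV[R]_n) (e / n.+1%:R) (g y)].
    apply/uniform_nbhs; exists [set xy | ball xy.1 (e / n.+1%:R) xy.2]; split=> //.
    exact: (entourage_ball _ (PosNum e1)).
  exists g; split=> //; first exact/eqP.
  move=> y /ge; rewrite -ball_normE /= distrC => /ltW yg.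
  apply: le_trans (eucl_norm_le_mx_norm _) _.
  apply: (@le_trans _ _ (n.+1%:R * `|g y - y|)); first by rewrite ler_wpM2r// ler_nat.
  by rewrite mulrC -ler_pdivlMr.
move=> /uniform_nbhs[E [+ EU]]; rewrite -entourage_ballE => -[e /= e0 eE].
have [|g [Qg gid ge]] := Qid (e / 2); first by rewrite divr_gt0.
exists g; split=> //; first exact/eqP.
apply: EU => y /ge ye /=; apply: eE => /=; rewrite -ball_normE /= distrC.
apply: le_lt_trans (mx_norm_le_eucl_norm _) _; apply: le_lt_trans ye _.
by rewrite ltr_pdivrMr// mulr_natr mulr2n ltrDl.
Qed.

End Affine.

(** * Cylinders and packings *)

Section IFS.
Context {R : realType} {n : nat} {I : finType}.
Context {S : I -> 'rV[R]_n -> 'rV[R]_n} {F : set 'rV[R]_n}.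
Context {ratio : I -> R} {cmin cmax Delta : R}.
Hypothesis ratioP : forall i x y,
  eucl_dist (S i x) (S i y) = ratio i * eucl_dist x y.
Hypothesis cmin_gt0 : 0 < cmin.
Hypothesis ratio_ge : forall i, cmin <= ratio i.
Hypothesis ratio_le : forall i, ratio i <= cmax.
Hypothesis cmax_lt1 : cmax < 1.
Hypothesis F_attr : attractor S F.
Hypothesis Delta_gt0 : 0 < Delta.
Hypothesis F_small : small F Delta.
Implicit Types (u v w : seq I).
Local Notation "'S_ w" := (word_map S w) (at level 8, w at level 2, format "''S_' w").

Definition rho w : R := \prod_(i <- w) ratio i.

Lemma ratio_gt0 i : 0 < ratio i. Proof. exact: lt_le_trans (ratio_ge i). Qed.

Lemma ratio_lt1 i : ratio i < 1. Proof. exact: le_lt_trans (ratio_le i) _. Qed.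

Lemma rho_gt0 w : 0 < rho w.
Proof. by rewrite /rho big_seq prodr_gt0// => i _; exact: ratio_gt0. Qed.

Lemma rho_cat u v : rho (u ++ v) = rho u * rho v.
Proof. by rewrite /rho big_cat. Qed.

Lemma rho_cons i w : rho (i :: w) = ratio i * rho w.
Proof. by rewrite /rho big_cons. Qed.

Lemma rho_le w : rho w <= cmax ^+ size w.
Proof.
elim: w => [|i w IH]; first by rewrite /rho big_nil.
by rewrite rho_cons exprS; apply: ler_pM => //; rewrite ltW ?ratio_gt0 ?rho_gt0.
Qed.

Lemma word_map_cat u v x : 'S_(u ++ v) x = 'S_u ('S_v x).
Proof. by elim: u => //= i u ->. Qed.

Lemma word_map_dist w x y : eucl_dist ('S_w x) ('S_w y) = rho w * eucl_dist x y.
Proof.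
elim: w => [|i w IH] /=; first by rewrite /rho big_nil mul1r.
by rewrite ratioP IH rho_cons mulrA.
Qed.

Lemma word_map_attractor w x : F x -> F ('S_w x).
Proof.
case: F_attr => _ _ FE Fx; elim: w => //= i w IH.
by rewrite FE; exists i => //; exists ('S_w x).
Qed.

Lemma attractor_neq0 : F !=set0. Proof. by case: F_attr. Qed.

Lemma attractor_compact : compact F. Proof. by case: F_attr. Qed.

Lemma exists_small_power (r : R) : 0 < r -> exists k, cmax ^+ k < r.
Proof.
move=> r0; have [i] : exists i : I, True.
  have [x] := attractor_neq0; case: F_attr => _ _ -> [i _ _].
  by exists i.
move=> _; have cmax0 : 0 < cmax by exact: lt_le_trans (ratio_gt0 i) (ratio_le i).
have /cvg_expr/cvgr0Pnorm_lt/(_ r r0)[N _ /(_ N (leqnn N))] : `|cmax| < 1.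
  by rewrite gtr0_norm.
by rewrite normrX gtr0_norm// => h; exists N.
Qed.

(** An address of y is cut where its ratio first falls to r, and the last letter costs at most the
    factor [cmin]. The minimum with 1 accounts for the empty word. *)
Lemma exists_cylinder y (r : R) : F y -> 0 < r -> exists w z,
  [/\ F z, y = 'S_w z, rho w <= r & cmin * Num.min r 1 <= rho w].
Proof.
move=> Fy r0; have cmin1 : cmin <= 1.
  have : F y by []. case: F_attr => _ _ -> [i _ _].
  by apply: le_trans (ratio_ge i) _; exact: ltW (ratio_lt1 i).
have [r1|r1] := leP 1 r.
  exists [::], y; rewrite /rho big_nil; split=> //.
  by rewrite mulr1.
have step k : (exists w z, [/\ F z, y = 'S_w z, rho w <= r & cmin * r <= rho w])
    \/ exists w z, [/\ size w = k, F z, y = 'S_w z & r < rho w].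
  elim: k => [|k [IH|[w [z [wk Fz yz rw]]]]]; [right|by left|].
    by exists [::], y; rewrite /rho big_nil.
  have := Fz; case: F_attr => _ _ {1}-> [i _ [z' Fz' zz']].
  have yz' : y = 'S_(rcons w i) z' by rewrite -cats1 word_map_cat /= zz'.
  have rhoE : rho (rcons w i) = rho w * ratio i.
    by rewrite -cats1 rho_cat rho_cons /rho big_nil mulr1.
  have [rw'|rw'] := leP (rho (rcons w i)) r; [left|right]; exists (rcons w i), z'.
    split=> //; rewrite rhoE mulrC; apply: ler_pM => //; exact: ltW.
  by rewrite size_rcons wk.
have [k ck] := exists_small_power r0.
have [//|[w [z [wk _ _]]]] := step k.
by rewrite ltNge => /negP[]; apply: le_trans (rho_le w) _; rewrite wk ltW.
Qed.

(** Iterating the self-similarity equation gives covers at the scales [cmax ^+ k * Delta]. *)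
Lemma attractor_covered (r : R) : 0 < r -> exists m, coverable_by F r m.
Proof.
move=> r0; have rD0 : 0 < r / Delta by rewrite divr_gt0.
have [k] := exists_small_power rD0; rewrite ltr_pdivlMr// => /ltW ck.
suff [m Fm] : exists m, coverable_by F (cmax ^+ k * Delta) m.
  by exists m; exact: coverable_le_scale ck Fm.
elim: k {ck} => [|k [m Fm]].
  by exists 1%N; rewrite mul1r; exact: coverable_small.
exists (\sum_(i <- enum I) m)%N.
apply: (@coverable_bigcup _ _ I _ (fun i => S i @` F)) => [x|i _].
  by case: F_attr => _ _ {1}-> [i _ Six]; exists i; rewrite ?mem_enum.
apply: (@coverable_le_scale _ _ _ (ratio i * (cmax ^+ k * Delta))).
  rewrite exprS -mulrA ler_wpM2r ?ratio_le// mulr_ge0 ?exprn_ge0 ?ltW//.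
  exact: lt_le_trans (ratio_gt0 i) (ratio_le i).
by apply: coverable_image => //; exact: ltW (ratio_gt0 i).
Qed.

(** Indices of any type name words through [a], so that net points or pairs of words can index
    cylinders. *)
Definition separated_pieces (T : eqType) (J : seq T) (a : T -> seq I) :=
  exists2 eta, 0 < eta & forall u v : T, u \in J -> v \in J -> u != v ->
    forall x y, F x -> F y -> eta <= eucl_dist ('S_(a u) x) ('S_(a v) y).

(* Strong induction on the size of a cover: a cover by sets of diameter less
   than [eta] splits into strictly smaller covers of the pieces, which pull back
   to covers of [F]. *)
Lemma separated_finite_content (T : eqType) (J : seq T) (a : T -> seq I) t eta :
    uniq J -> 0 < eta -> (1 < size J)%N ->
    (forall u v : T, u \in J -> v \in J -> u != v ->
      forall x y, F x -> F y -> eta <= eucl_dist ('S_(a u) x) ('S_(a v) y)) ->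
    0 <= t -> 1 <= \sum_(w <- J) rho (a w) `^ t ->
  finite_content_ge F t (eta `^ t).
Proof.
move=> uJ eta0 J1 Jsep t0 sum1 L.
have [N] := ubnP (size L); elim: N L => // N IH L LN U r r0 Ur FU.
(* A set of size at least eta alone carries the required sum. *)
have [/hasP[j jL rj]|/hasPn rlt] := boolP (has (fun j => eta <= r j) L).
  rewrite (big_rem j)//= -[leLHS]addr0; apply: lerD; last first.
    by apply: sumr_ge0 => i _; exact: powR_ge0.
  by apply: ge0_ler_powR => //; rewrite nnegrE ltW.
pose P (w : T) j := `[< exists x, F x /\ U j ('S_(a w) x) >].
have Pinj j (u v : T) : j \in L -> u \in J -> v \in J -> P u j -> P v j -> u = v.
  move=> jL uu vv /asboolP[x [Fx Ux]] /asboolP[y [Fy Uy]].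
  apply/eqP/negPn/negP => uv; have := Jsep u v uu vv uv x y Fx Fy.
  by move=> /le_trans/(_ (Ur j _ _ Ux Uy)); exact/negP/rlt.
have Lw (w : T) : F `<=` [set x | exists2 j, j \in L & P w j /\ U j ('S_(a w) x)].
  move=> x Fx; have [j jL Ujx] := FU _ (word_map_attractor (a w) Fx).
  by exists j => //; split=> //; apply/asboolP; exists x.
have Lsize (w : T) : w \in J -> (size [seq j <- L | P w j] < N)%N.
  move=> wJ; apply: (@leq_trans (size L)) => //.
  rewrite size_filter ltn_neqAle count_size andbT -all_count.
  (* A point of another piece lies in a set that misses the piece of w, so the cover of that piece
     is strictly shorter. *)
  have [w' w'J w'w] : exists2 w', w' \in J & w' != w.
    case: (J) uJ J1 => [//|u [//|v l]] /= /andP[+ _] _.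
    rewrite inE negb_or => /andP[uv _].
    have [<-|uw] := eqVneq u w; last by exists u; rewrite ?inE ?eqxx.
    by exists v; rewrite ?inE ?eqxx ?orbT // eq_sym.
  have [x Fx] := attractor_neq0; have [j jL [Pw' _]] := Lw w' x Fx.
  apply/allPn; exists j => //; apply/negP => Pw.
  by move: w'w; rewrite (Pinj j w' w)// eqxx.
have Lmass (w : T) : w \in J ->
    rho (a w) `^ t * eta `^ t <= \sum_(j <- L | P w j) r j `^ t.
  move=> wJ; have rw0 := rho_gt0 (a w).
  have := IH [seq j <- L | P w j] (Lsize w wJ) (fun j => 'S_(a w) @^-1` U j)
    (fun j => r j / rho (a w)).
  move=> /(_ (fun j => divr_gt0 (r0 j) rw0)) h.
  have {h}/h h : forall j, small ('S_(a w) @^-1` U j) (r j / rho (a w)).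
    move=> j x y Ux Uy; rewrite ler_pdivlMr// mulrC -word_map_dist.
    exact: (Ur j).
  have {h}/h : forall x, F x -> exists2 j, j \in [seq j <- L | P w j] &
      ('S_(a w) @^-1` U j) x.
    move=> x /(Lw w)[j jL [Pj Ux]]; exists j => //.
    by rewrite mem_filter Pj.
  rewrite big_filter => h; rewrite mulrC -ler_pdivlMr ?powR_gt0//.
  apply: le_trans h _; rewrite mulr_suml; apply: ler_sum => j _.
  by rewrite powR_div//; exact: ltW.
rewrite -[leLHS]mul1r.
apply: le_trans (ler_wpM2r (powR_ge0 _ _) sum1) _.
rewrite mulr_suml big_seq.
apply: le_trans (ler_sum _ Lmass) _.
rewrite -big_seq (exchange_big_dep xpredT)//= big_seq [leRHS]big_seq.
apply: ler_sum => j jL; apply: sumr_filter_le1; rewrite ?powR_ge0//.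
by move=> u v uu vv; exact: Pinj.
Qed.

Context {s : R}.
Hypothesis F_dim : hausdorff_dim F = s%:E.

Let s_ge0 : 0 <= s := hausdorff_dim_ge0 F_dim.

Lemma rho_le1 w : rho w <= 1.
Proof.
elim: w => [|i w IH]; first by rewrite /rho big_nil.
rewrite rho_cons; apply: mulr_ile1 => //; [|exact: ltW (rho_gt0 w)|].
  exact: ltW (ratio_gt0 i).
exact: ltW (ratio_lt1 i).
Qed.

(* Otherwise the sum would still be at least 1 for some exponent larger than the
   dimension. *)
Lemma separated_pieces_le1 (T : eqType) (J : seq T) (a : T -> seq I) :
  uniq J -> separated_pieces J a -> \sum_(w <- J) rho (a w) `^ s <= 1.
Proof.
move=> uJ [eta eta0 Jsep]; rewrite leNgt; apply/negP => sum1.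
have J1 : (1 < size J)%N.
  case: (J) sum1 => [|u [|v l]] //; first by rewrite big_nil ltNge ler01.
  rewrite big_seq1 ltNge -(powRr0 (rho (a u))) => /negP[]; apply: ger_powR => //.
  by rewrite rho_gt0 rho_le1.
have [e e0 eJ] := pos_lower_bound (fun j (_ : j \in J) => rho_gt0 (a j)).
have e'01 : 0 < Num.min e (1/2) < 1.
  by rewrite lt_min e0 gt_min; apply/andP; split; [|apply/orP; right]; lra.
(* All ratios are at least the minimum of e and 1/2, so raising the exponent by tau divides the sum
   at most by its value at s, which leaves at least 1. *)
have [tau [/andP[tau0 _] qe]] := powR_near1 e'01 sum1 ltr01.
have st : s < s + tau by rewrite ltrDl.
have t0 : 0 <= s + tau by rewrite addr_ge0// ltW.
suff /(separated_finite_content uJ eta0 J1 Jsep t0) :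
    1 <= \sum_(w <- J) rho (a w) `^ (s + tau).
  move=> /(finite_content_le_dim attractor_compact F_dim (powR_gt0 _ eta0)).
  by rewrite leNgt st.
set Q := \sum_(w <- J) _ in sum1 qe.
have Q0 : 0 < Q by exact: lt_trans sum1.
rewrite -(mulfV (lt0r_neq0 Q0)); apply: le_trans (ler_wpM2l (ltW Q0) qe) _.
rewrite /Q mulr_suml big_seq [leRHS]big_seq; apply: ler_sum => w wJ.
rewrite powRD; last by rewrite (gt_eqF (rho_gt0 _)) implybT.
rewrite ler_wpM2l ?powR_ge0//; apply: ge0_ler_powR.
- exact: ltW.
- by rewrite nnegrE ltW//; case/andP: e'01.
- by rewrite nnegrE ltW// rho_gt0.
- by rewrite ge_min eJ.
Qed.

(** * Packing of separated cylinders inside a ball *)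

Section LocalPacking.
Context {h r : R} {x : 'rV[R]_n}.
Hypothesis h_gt0 : 0 < h.
Hypothesis F_content : finite_content_ge F s h.
Hypothesis Fx : F x.
Hypothesis r_gt0 : 0 < r.

(** S_u maps the ball of radius r about x to the ball of radius [rho u * r] about S_u x; these image
    balls have mutual distances bounded below. *)
Let gapped (W : seq (seq I)) := uniq W /\ exists2 eta, 0 < eta &
  forall u v, u \in W -> v \in W -> u != v ->
    eta + rho u * r + rho v * r <= eucl_dist ('S_u x) ('S_v x).

(* Small cylinders around a net of the part of [F] that the doubled balls of [W]
   leave uncovered. *)
Lemma extend_gapped : exists2 c, 0 < c & forall W, gapped W ->
  \sum_(w <- W) (4 * rho w * r) `^ s <= h / 2 ->
  exists2 W', gapped W' &
    \sum_(w <- W) rho w `^ s + c <= \sum_(w <- W') rho w `^ s.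
Proof.
(* Net points [K * tau] apart leave room for gapped balls of cylinders of ratio at most tau. *)
pose K := 2 * Delta + 2 * r + 1.
have K0 : 0 < K by rewrite /K; move: (Delta_gt0) (r_gt0); lra.
have K1 : 0 < K + 1 by move: K0; lra.
have c0 : 0 < cmin / (2 * K) by rewrite divr_gt0// mulr_gt0.
(* The net balls have size [2 * (K * tau)] and carry at least h / 2; cylinders of ratio at least
   [cmin * tau] replace them. *)
exists (h / 2 * (cmin / (2 * K)) `^ s); first by rewrite mulr_gt0 ?divr_gt0 ?powR_gt0.
move=> W [uW [eta eta0 Wgap]] Wsum.
have [e e0 eW] := pos_lower_bound (fun w (_ : w \in W) => rho_gt0 w).
(* So small that the room [rho w * r] left by the doubled balls of [W] suffices for the new
   balls. *)
pose tau := Num.min 1 (e * r / (K + 1)).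
have tau0 : 0 < tau by rewrite lt_min ltr01 divr_gt0// mulr_gt0.
have tau1 : tau <= 1 by rewrite ge_min lexx.
have tauW w : w \in W -> tau * (K + 1) <= rho w * r.
  move=> /eW ew; rewrite -ler_pdivlMr//.
  apply: (@le_trans _ _ (e * r / (K + 1))); first by rewrite ge_min lexx orbT.
  apply: ler_wpM2r; first by rewrite invr_ge0 ltW.
  by apply: ler_wpM2r => //; exact: ltW.
have Ktau0 : 0 < K * tau by rewrite mulr_gt0.
pose L := F `&` [set y | forall w, w \in W -> 2 * rho w * r < eucl_dist ('S_w x) y].
have [m Fm] := attractor_covered Ktau0.
have LF : L `<=` F by move=> y [].
have [Y [uY YL Ysep LY]] := separated_net (coverableS LF Fm).
have /choice[om omP] y : exists w, F y -> exists z,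
    [/\ F z, y = 'S_w z, rho w <= tau & cmin * tau <= rho w].
  have [Fy|nFy] := pselect (F y); last by exists [::].
  have [v [z [Fz yz v1 v2]]] := exists_cylinder Fy tau0.
  by exists v => _; exists z; split=> //; move: v2; rewrite min_l.
have om_le y : F y -> rho (om y) <= tau by move=> /omP[z []].
have om_ge y : F y -> cmin * tau <= rho (om y) by move=> /omP[z []].
have om_dist y : F y -> eucl_dist y ('S_(om y) x) <= tau * Delta.
  move=> Fy; have [z [Fz yz w1 _]] := omP y Fy; rewrite {1}yz word_map_dist.
  by apply: ler_pM => //; [exact: ltW (rho_gt0 _)|exact: eucl_dist_ge0|exact: F_small].
have rr y : F y -> rho (om y) * r <= tau * r.
  by move=> Fy; rewrite ler_pM2r// om_le.
have gapY y y' : y \in Y -> y' \in Y -> y != y' ->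
    tau + rho (om y) * r + rho (om y') * r <= eucl_dist ('S_(om y) x) ('S_(om y') x).
  move=> yY y'Y yy'; have [Fy _] := YL y yY; have [Fy' _] := YL y' y'Y.
  have := Ysep y y' yY y'Y yy'; have := om_dist y Fy; have := om_dist y' Fy'.
  have := rr y Fy; have := rr y' Fy'.
  have := eucl_dist_triangle ('S_(om y) x) y y'.
  have := eucl_dist_triangle ('S_(om y') x) ('S_(om y) x) y'.
  by rewrite (eucl_distC ('S_(om y') x) y') /K; lra.
have gapWY w y : w \in W -> y \in Y ->
    tau + rho w * r + rho (om y) * r <= eucl_dist ('S_w x) ('S_(om y) x).
  move=> wW yY; have [Fy /(_ w wW)] := YL y yY; have := om_dist y Fy.
  have := rr y Fy; have := tauW w wW.
  have := eucl_dist_triangle ('S_(om y) x) ('S_w x) y.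
  have := mulr_gt0 tau0 r_gt0; have := mulr_gt0 tau0 Delta_gt0.
  by rewrite (eucl_distC ('S_(om y) x) y) /K; lra.
have disj w y : w \in W -> y \in Y -> w != om y.
  move=> wW yY; apply/eqP => wy; have := gapWY w y wW yY; rewrite wy eucl_distxx.
  have := mulr_gt0 (rho_gt0 (om y)) r_gt0; move: tau0; lra.
have uY' : uniq (map om Y).
  rewrite map_inj_in_uniq// => y y' yY y'Y yy'; apply/eqP/negPn/negP => nyy'.
  have := gapY y y' yY y'Y nyy'; rewrite yy' eucl_distxx.
  have := mulr_gt0 (rho_gt0 (om y')) r_gt0; move: tau0; lra.
exists (W ++ map om Y).
  split.
    rewrite cat_uniq uW uY' andbT; apply/hasPn => _ /mapP[y yY ->].
    by apply/negP => oW; have := disj _ y oW yY; rewrite eqxx.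
  exists (Num.min eta tau); first by rewrite lt_min eta0.
  move=> u v; rewrite !mem_cat => /orP[uu|/mapP[y yY ->]] /orP[vv|/mapP[y' y'Y ->]] uv.
  - apply: le_trans (Wgap u v uu vv uv).
    by rewrite -!addrA lerD2r ge_min lexx.
  - apply: le_trans (gapWY u y' uu y'Y).
    by rewrite -!addrA lerD2r ge_min lexx orbT.
  - rewrite eucl_distC; apply: le_trans (gapWY v y vv yY).
    by rewrite addrAC -!addrA lerD2r ge_min lexx orbT.
  - have yy' : y != y' by apply: contraNneq uv => ->.
    apply: le_trans (gapY y y' yY y'Y yy').
    by rewrite -!addrA lerD2r ge_min lexx orbT.
rewrite big_cat /= lerD2l big_map.
have Fcov := finite_content_seq (J := map inl W ++ map inr Y)
  (U := fun j => match j with inl w => eucl_cball ('S_w x) (2 * rho w * r)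
                 | inr y => eucl_cball y (K * tau) end)
  (r := fun j => match j with inl w => 4 * rho w * r | inr y => 2 * (K * tau) end)
  F_content.
have {}Fcov : h <= \sum_(w <- W) (4 * rho w * r) `^ s +
    \sum_(y <- Y) (2 * (K * tau)) `^ s.
  move: Fcov; rewrite big_cat !big_map; apply.
  - by move=> [w|y]; rewrite !mulr_gt0 ?rho_gt0.
  - move=> [w|y]; last exact: small_eucl_cball.
    have -> : 4 * rho w * r = 2 * (2 * rho w * r) by lra.
    exact: small_eucl_cball.
  - move=> y Fy; have [Ly|] := pselect (L y).
      have [y' y'Y yy'] := LY y Ly; exists (inr y'); last first.
        by rewrite /eucl_cball /= eucl_distC.
      by rewrite mem_cat map_f ?orbT.
    move=> /not_andP[//|/existsNP[w /not_implyP[wW /negP]]].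
    rewrite -leNgt => wy; exists (inl w) => //.
    by rewrite mem_cat map_f.
have Ysum : h / 2 <= \sum_(y <- Y) (2 * (K * tau)) `^ s by move: Fcov Wsum; lra.
apply: le_trans (ler_wpM2r (powR_ge0 _ _) Ysum) _.
rewrite mulr_suml big_seq [leRHS]big_seq; apply: ler_sum => y yY.
have p1 : 0 <= 2 * (K * tau) by move: Ktau0; lra.
rewrite -powRM//; last exact: ltW.
have -> : 2 * (K * tau) * (cmin / (2 * K)) = cmin * tau.
  by field; rewrite gt_eqF.
have [Fy _] := YL y yY.
by apply: ge0_ler_powR; rewrite ?nnegrE ?om_ge// ltW ?rho_gt0// mulr_gt0.
Qed.

(* Every ball of a gapped family contains a copy of [D], so the sum over the
   family times the sum over [D] is at most 1, while the family can be extended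
   until its balls carry half of the content of [F]. *)
Lemma local_packing (T : eqType) (D : seq T) (a : T -> seq I) :
    uniq D -> separated_pieces D a ->
    (forall d y, d \in D -> F y -> eucl_dist x ('S_(a d) y) <= r) ->
  \sum_(d <- D) rho (a d) `^ s <= 2 / h * (4 * r) `^ s.
Proof.
move=> uD [etaD etaD0 Dsep] Dr; set Q := \sum_(d <- D) _.
(* The cylinders of [D] lie in the ball of radius r about x, so the concatenations of words of [W]
   and [D] are separated, and masses multiply. *)
have QW W : gapped W -> (\sum_(w <- W) rho w `^ s) * Q <= 1.
  move=> [uW [eta eta0 Wgap]].
  have -> : (\sum_(w <- W) rho w `^ s) * Q =
      \sum_(p <- [seq (w, d) | w <- W, d <- D]) rho (p.1 ++ a p.2) `^ s.
    rewrite big_allpairs mulr_suml; apply: eq_bigr => w _.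
    rewrite mulr_sumr; apply: eq_bigr => d _ /=.
    by rewrite rho_cat powRM// ltW// rho_gt0.
  apply: separated_pieces_le1; first by rewrite allpairs_uniq//; move=> [? ?] [? ?].
  have [e e0 eW] := pos_lower_bound (fun w (_ : w \in W) => rho_gt0 w).
  exists (Num.min eta (e * etaD)); first by rewrite lt_min eta0 mulr_gt0.
  move=> [w d] [w' d'] /allpairsP[[? ?] /= [wW dD e1]].
  case: e1 wW dD => <- <- wW dD.
  move=> /allpairsP[[? ?] /= [wW' dD' e2]].
  case: e2 wW' dD' => <- <- wW' dD' ne y z Fy Fz.
  rewrite !word_map_cat /=; have [ww'|ww'] := eqVneq w w'.
    rewrite -ww' word_map_dist ge_min; apply/orP; right.
    apply: ler_pM; [exact: ltW|exact: ltW|exact: eW|apply: Dsep => //].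
    by apply: contraNneq ne => ->; rewrite ww'.
  rewrite ge_min; apply/orP; left.
  have := Wgap w w' wW wW' ww'.
  have := eucl_dist_triangle ('S_w ('S_(a d) y)) ('S_w x) ('S_w' x).
  have := eucl_dist_triangle ('S_w' ('S_(a d') z)) ('S_w ('S_(a d) y)) ('S_w' x).
  have := ler_wpM2l (ltW (rho_gt0 w)) (Dr d y dD Fy).
  have := ler_wpM2l (ltW (rho_gt0 w')) (Dr d' z dD' Fz).
  rewrite -!word_map_dist (eucl_distC ('S_w' _) ('S_w' x)); lra.
have [Q0|Q0] := leP Q 0.
  by apply: le_trans Q0 _; rewrite mulr_ge0 ?powR_ge0// divr_ge0// ltW.
rewrite leNgt; apply/negP => Qbig.
have [c c0 ext] := extend_gapped.
(* While the bound fails, [QW] keeps the mass of [W] at most 1 / Q and the sum over its doubled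
   balls at most h / 2; each extension then adds c, which finally contradicts [QW]. *)
have grow k : exists2 W, gapped W & k%:R * c <= \sum_(w <- W) rho w `^ s.
  elim: k => [|k [W Wg kW]].
    by exists [::]; [split=> //; exists 1|rewrite mul0r big_nil].
  have [|W' W'g W'W] := ext W Wg; last first.
    by exists W' => //; move: kW W'W; rewrite -natr1; lra.
  have -> : \sum_(w <- W) (4 * rho w * r) `^ s =
      (4 * r) `^ s * \sum_(w <- W) rho w `^ s.
    rewrite mulr_sumr; apply: eq_bigr => w _.
    have w0 := ltW (rho_gt0 w).
    have r40 : 0 <= 4 * r by rewrite mulr_ge0// ltW.
    by rewrite mulrAC [LHS]powRM.
  have := QW W Wg; have /(powR_gt0 s) : 0 < 4 * r by rewrite mulr_gt0.
  set m := \sum_(w <- W) _; set q := (4 * r) `^ s => q0 mQ.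
  have qQ : q <= Q * (h / 2).
    by rewrite -ler_pdivrMr ?divr_gt0// invf_div mulrC ltW.
  rewrite -(ler_pM2r Q0) -mulrA; apply: le_trans (ler_wpM2l (ltW q0) mQ) _.
  by rewrite mulr1 mulrC.
have [k kc] : exists k : nat, Q^-1 / c < k%:R.
  exists (Num.bound (Q^-1 / c)); apply: archi_boundP.
  by rewrite divr_ge0 ?invr_ge0// ltW.
have [W /QW Wg kW] := grow k.
move: Wg; rewrite -ler_pdivlMr// div1r => Wg.
by move: kc; rewrite ltr_pdivrMr// ltNge (le_trans kW).
Qed.

End LocalPacking.

(** * Covering numbers bounded through packings *)

Lemma net_pieces A (d : R) : A `<=` F -> 0 < d ->
  exists (Y : seq 'rV[R]_n) (om : 'rV[R]_n -> seq I),
    [/\ uniq Y, coverable_by A d (size Y), separated_pieces Y om,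
        forall y, y \in Y -> A y /\ forall z, F z -> eucl_dist y ('S_(om y) z) <= d &
        forall y, y \in Y -> cmin * Num.min (d / (8 * Delta)) 1 <= rho (om y)].
Proof.
move=> AF d0; have d20 : 0 < d / 2 by rewrite divr_gt0.
have [m Fm] := attractor_covered d20.
have [Y [uY YA Ysep AY]] := separated_net (coverableS AF Fm).
(* Cylinders of this ratio have diameter at most d / 8, so about points more than d / 2 apart they
   keep a distance of at least d / 4. *)
have tau0 : 0 < d / (8 * Delta) by rewrite divr_gt0// mulr_gt0.
have /choice[om omP] y : exists w, F y -> exists z, [/\ F z, y = 'S_w z,
    rho w <= d / (8 * Delta) & cmin * Num.min (d / (8 * Delta)) 1 <= rho w].
  have [Fy|nFy] := pselect (F y); last by exists [::].
  by have [v [z vz]] := exists_cylinder Fy tau0; exists v => _; exists z.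
have om_dist y z : F y -> F z -> eucl_dist y ('S_(om y) z) <= d / 8.
  move=> Fy Fz; have [z' [Fz' yz' w1 _]] := omP y Fy; rewrite {1}yz' word_map_dist.
  have -> : d / 8 = d / (8 * Delta) * Delta by field; rewrite gt_eqF.
  by apply: ler_pM => //; [exact: ltW (rho_gt0 _)|exact: eucl_dist_ge0|exact: F_small].
exists Y, om; split=> //.
- exists (fun i => eucl_cball (tnth (in_tuple Y) i) (d / 2)); split.
    move=> x /AY[y yY xy]; have yY' := yY; rewrite -index_mem in yY'.
    exists (Ordinal yY') => //.
    by rewrite /eucl_cball (tnth_nth y) /= nth_index// eucl_distC.
  have {2}-> : d = 2 * (d / 2) by field.
  by move=> i; exact: small_eucl_cball.
- exists (d / 4); first by rewrite divr_gt0.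
  move=> y y' yY y'Y yy' z z' Fz Fz'.
  have := Ysep y y' yY y'Y yy'.
  have := om_dist y z (AF _ (YA y yY)) Fz; have := om_dist y' z' (AF _ (YA y' y'Y)) Fz'.
  have := eucl_dist_triangle ('S_(om y) z) y y'.
  have := eucl_dist_triangle ('S_(om y') z') ('S_(om y) z) y'.
  by rewrite (eucl_distC ('S_(om y') z') y'); lra.
- move=> y yY; split=> [|z Fz]; first exact: YA.
  by apply: le_trans (om_dist y z (AF _ (YA y yY)) Fz) _; move: d0; lra.
- by move=> y yY; have [z []] := omP y (AF _ (YA y yY)).
Qed.

Lemma net_pieces_size (Y : seq 'rV[R]_n) (om : 'rV[R]_n -> seq I) (d q : R) :
    0 < d -> d <= 8 * Delta ->
    (forall y, y \in Y -> cmin * Num.min (d / (8 * Delta)) 1 <= rho (om y)) ->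
    \sum_(y <- Y) rho (om y) `^ s <= q ->
  (size Y)%:R <= (8 * Delta / cmin) `^ s * (q * d^-1 `^ s).
Proof.
move=> d0 dD Yom Yq; have D0 : 0 < 8 * Delta by rewrite mulr_gt0.
have e0 : 0 < cmin * (d / (8 * Delta)) by rewrite mulr_gt0// divr_gt0.
have : \sum_(y <- Y) (cmin * (d / (8 * Delta))) `^ s <= q.
  apply: le_trans Yq; rewrite big_seq [leRHS]big_seq; apply: ler_sum => y /Yom.
  rewrite min_l ?ler_pdivrMr ?mul1r// => yom.
  by apply: ge0_ler_powR => //; rewrite nnegrE ltW// rho_gt0.
rewrite big_const_seq count_predT iter_addr_0 -[X in X <= q -> _]mulr_natl.
rewrite -ler_pdivlMr ?powR_gt0// => /le_trans; apply.
have -> : (cmin * (d / (8 * Delta))) = (8 * Delta / cmin * d^-1)^-1.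
  by field; rewrite !gt_eqF//; move: D0; lra.
have e1 : 0 < 8 * Delta / cmin * d^-1 by rewrite !mulr_gt0// invr_gt0.
rewrite powR_inv// invrK.
rewrite powRM ?invr_ge0 ?(ltW d0)//; last by rewrite divr_ge0// ltW.
by rewrite mulrCA.
Qed.

(** The pieces about a net of [F] have total mass at most 1. The summand 1 in the constant serves
    scales above [8 * Delta], where one set suffices. *)
Lemma attractor_covered_upper : exists2 C, 1 <= C & forall d : R, 0 < d <= 1 ->
  exists2 m, coverable_by F d m & m%:R <= C * d^-1 `^ s.
Proof.
exists (1 + (8 * Delta / cmin) `^ s); first by rewrite lerDl powR_ge0.
move=> d /andP[d0 d1]; have d1' : 1 <= d^-1 `^ s.
  by rewrite -(powRr0 d^-1); apply: ler_powR => //; rewrite invf_ge1.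
have [dD|dD] := leP d (8 * Delta); last first.
  exists 1%N.
    by apply: coverable_small; apply: le_small F_small; move: dD Delta_gt0; lra.
  by rewrite mulrDl mul1r -[leLHS]addr0 lerD// mulr_ge0 ?powR_ge0.
have [Y [om [uY FY Ysep _ Yom]]] := net_pieces (@subset_refl _ F) d0.
exists (size Y) => //; rewrite mulrDl mul1r.
have := net_pieces_size d0 dD Yom (separated_pieces_le1 uY Ysep).
by rewrite mul1r; have := powR_ge0 d^-1 s; lra.
Qed.

(** As d is at most r, the pieces about a net of the ball stay within radius 2 * r of x, where
    [local_packing] bounds their mass. *)
Lemma local_covered_upper h : 0 < h -> finite_content_ge F s h ->
  exists2 C, 1 <= C & forall (x : 'rV[R]_n) (d r : R), F x -> 0 < d -> d <= r ->
    exists2 m, coverable_by (F `&` eucl_cball x r) d m & m%:R <= C * (r / d) `^ s.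
Proof.
move=> h0 Fh; pose C := (8 * Delta / cmin) `^ s * (2 / h * 8 `^ s).
have C0 : 0 <= C by rewrite !mulr_ge0 ?powR_ge0// invr_ge0 ltW.
exists (1 + C); first by rewrite lerDl.
move=> x d r Fx d0 dr; have r0 := lt_le_trans d0 dr.
have rd1 : 1 <= (r / d) `^ s.
  rewrite -(powRr0 (r / d)); apply: ler_powR => //.
  by rewrite ler_pdivlMr// mul1r.
have [dD|dD] := leP d (8 * Delta); last first.
  exists 1%N.
    apply: (coverableS (@subIsetl _ _ _)); apply: coverable_small.
    by apply: le_small F_small; move: dD Delta_gt0; lra.
  by rewrite mulrDl mul1r -[leLHS]addr0 lerD// mulr_ge0 ?powR_ge0.
have [Y [om [uY FY Ysep YF Yom]]] := net_pieces (@subIsetl _ F (eucl_cball x r)) d0.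
exists (size Y) => //.
have r20 : 0 < 2 * r by rewrite mulr_gt0.
have Yx y z : y \in Y -> F z -> eucl_dist x ('S_(om y) z) <= 2 * r.
  move=> /YF[[_ xy] /[apply]] yz; have := eucl_dist_triangle y x ('S_(om y) z).
  by move: xy yz dr; rewrite /eucl_cball /=; lra.
have := net_pieces_size d0 dD Yom (local_packing h0 Fh Fx r20 uY Ysep Yx).
have -> : 4 * (2 * r) = 8 * r by lra.
rewrite (@powRM _ 8 r) ?(ltW r0)// => Ysize; rewrite mulrDl mul1r.
have -> : C * (r / d) `^ s = (8 * Delta / cmin) `^ s *
    (2 / h * (8 `^ s * r `^ s) * d^-1 `^ s).
  by rewrite /C (@powRM _ r) ?invr_ge0 ?(ltW r0) ?(ltW d0)//; ring.
by move: Ysize rd1; lra.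
Qed.

(** * Regularity and Assouad exponent from positive content *)

Section PositiveContent.
Context {h : R}.
Hypothesis h_gt0 : 0 < h.
Hypothesis F_content : finite_content_ge F s h.

Lemma content_measure_upper : exists2 C, 1 <= C & forall (x : 'rV[R]_n) (r : R),
  F x -> 0 < r -> (hausdorff_measure s (F `&` eucl_cball x r) <= (C * r `^ s)%:E)%E.
Proof.
have [C C1 FC] := local_covered_upper h_gt0 F_content.
exists C => // x r Fx r0; apply: measure_le_covered => // d d0.
have e0 : 0 < Num.min d r by rewrite lt_min d0.
have er : Num.min d r <= r by rewrite ge_min lexx orbT.
have [m Fm mC] := FC x _ r Fx e0 er.
exists (Num.min d r), m; split=> //; first by rewrite e0 ge_min lexx.
rewrite -ler_pdivlMr ?powR_gt0//; apply: le_trans mC _.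
by rewrite powR_div ?(ltW r0)// mulrA.
Qed.

Lemma attractor_cball x : F x -> F `&` eucl_cball x Delta = F.
Proof.
move=> Fx; apply/seteqP; split=> [y []//|y Fy]; split=> //; exact: F_small.
Qed.

Lemma content_measure_fin : (hausdorff_measure s F < +oo)%E.
Proof.
have [x Fx] := attractor_neq0; have [C _ FC] := content_measure_upper.
rewrite -(attractor_cball Fx); apply: le_lt_trans (FC x _ Fx Delta_gt0) _.
exact: ltry.
Qed.

(** A cylinder through x of ratio about [r / Delta] lies in the ball, and its map pulls covers back
    to covers of [F]. *)
Lemma content_measure_lower : exists2 c, 0 < c & forall (x : 'rV[R]_n) (r : R),
  F x -> 0 < r -> r <= Delta ->
  ((c * r `^ s)%:E <= hausdorff_measure s (F `&` eucl_cball x r))%E.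
Proof.
have cD0 : 0 < cmin / Delta by rewrite divr_gt0.
exists ((cmin / Delta) `^ s * h); first by rewrite mulr_gt0 ?powR_gt0.
move=> x r Fx r0 rD; apply: finite_content_le_measure => //.
  by apply: compact_closedI; [exact: attractor_compact|exact: closed_eucl_cball].
have [w [z [Fz xz w1 w2]]] := exists_cylinder Fx (divr_gt0 r0 Delta_gt0).
move=> J U e e0 Ue FU.
have Fh := F_content (J := J) (fun j => divr_gt0 (e0 j) (rho_gt0 w)).
have {}Fh := Fh (fun j => 'S_w @^-1` U j).
have /Fh{}Fh : forall j, small ('S_w @^-1` U j) (e j / rho w).
  move=> j y y' Uy Uy'; rewrite ler_pdivlMr ?rho_gt0// mulrC -word_map_dist.
  exact: (Ue j).
have /Fh{}Fh : forall y, F y -> exists2 j, j \in J & ('S_w @^-1` U j) y.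
  move=> y Fy; apply: FU; split; first exact: word_map_attractor.
  rewrite /eucl_cball /= xz word_map_dist.
  rewrite -[r](@divfK _ Delta) ?gt_eqF//.
  by apply: ler_pM => //; [exact: ltW (rho_gt0 w)|exact: eucl_dist_ge0|exact: F_small].
apply: (@le_trans _ _ (rho w `^ s * h)).
  rewrite mulrAC -powRM ?(ltW cD0) ?(ltW r0)// ler_wpM2r ?(ltW h_gt0)//.
  apply: ge0_ler_powR; rewrite ?nnegrE ?(ltW (rho_gt0 w))//.
    by rewrite mulr_ge0 ?ltW.
  move: w2; rewrite min_l ?ler_pdivrMr ?mul1r//.
  by rewrite mulrA mulrAC.
rewrite mulrC -ler_pdivlMr ?powR_gt0 ?rho_gt0// mulr_suml.
by apply: le_trans Fh _; apply: ler_sum => j _; rewrite powR_div ?rho_gt0// ltW.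
Qed.

Lemma content_assouad_exponent : assouad_exponent F s.
Proof.
have [C C1 FC] := local_covered_upper h_gt0 F_content.
exists C; first exact: lt_le_trans C1.
move=> r r' x r0 rr' Fx; have [m Fm mC] := FC x r r' Fx r0 (ltW rr').
by apply: covered_coverable Fm mC; exact: ltW.
Qed.

Lemma content_ahlfors_regular : ahlfors_regular F.
Proof.
have [C C1 FC] := content_measure_upper; have [c c0 Fc] := content_measure_lower.
exists s; split=> //; first exact: compact_bounded attractor_compact.
have C0 := lt_le_trans ltr01 C1.
exists (C + c^-1); first by rewrite -[leLHS]addr0 lerD// invr_ge0 ltW.
have Cc0 : 0 < C + c^-1 by rewrite addr_gt0// invr_gt0.
move=> x r Fx r0 rD; apply/andP; split.
  apply: le_trans (Fc x r Fx r0 _); last first.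
    by rewrite -lee_fin; apply: le_trans rD _; apply: small_diam; rewrite // ltW.
  rewrite lee_fin ler_wpM2r ?powR_ge0// -[leRHS]invrK lef_pV2 ?posrE ?invr_gt0//.
  by rewrite lerDr ltW.
apply: le_trans (FC x r Fx r0) _.
by rewrite lee_fin ler_wpM2r ?powR_ge0// lerDl invr_ge0 ltW.
Qed.

End PositiveContent.

(** At exponent a + e the covers have sums at most C * r^e, which tend to 0 with r, so the measure
    vanishes at every exponent above a. *)
Lemma dim_le_covered_pow (a C : R) : 0 <= a -> 0 < C ->
    (forall d, 0 < d <= Delta -> exists2 m, coverable_by F d m & m%:R <= C / d `^ a) ->
  s <= a.
Proof.
move=> a0 C0 FC; apply/ler_addgt0Pr => e e0.
apply: (hausdorff_dim_le F_dim); first by rewrite addr_ge0// ltW.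
apply/eqP; rewrite eq_le hausdorff_measure_ge0 andbT; apply/lee_addgt0Pr => eps eps0.
rewrite add0e; apply: measure_le_covered => [|d d0]; first by rewrite addr_ge0// ltW.
have [d1 d10 d1P] := powR_small e0 (divr_gt0 eps0 C0).
pose r := Num.min (Num.min d d1) Delta.
have r0 : 0 < r by rewrite !lt_min d0 d10.
have rD : r <= Delta by rewrite ge_min lexx orbT.
have rd : r <= d by rewrite !ge_min lexx.
have rd1 : r <= d1 by rewrite !ge_min lexx orbT.
have [|m Fm mC] := FC r; first by rewrite r0.
exists r, m; split=> //; first by rewrite r0.
rewrite powRD; last by rewrite (gt_eqF r0) implybT.
have ra0 := powR_gt0 a r0; rewrite mulrA.
have := d1P r; rewrite (ltW r0) rd1 => /(_ isT); rewrite ler_pdivlMr// mulrC.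
move: mC; rewrite ler_pdivlMr// => mC /(le_trans _); apply.
by rewrite ler_wpM2r ?powR_ge0.
Qed.

(** The ball of radius [2 * Delta] about a point of [F] contains [F]; the factor 2 keeps the scale
    strictly below the radius. *)
Lemma dim_le_assouad : (s%:E <= assouad_dim F)%E.
Proof.
apply: le_ereal_inf_tmp => _ [a [a0 [C C0 FC]] <-]; rewrite lee_fin.
have [x Fx] := attractor_neq0.
have D2 : 0 < (2 * Delta) `^ a by rewrite powR_gt0// mulr_gt0.
apply: (dim_le_covered_pow a0 (mulr_gt0 C0 D2)) => d /andP[d0 dD].
have dD2 : d < 2 * Delta by move: dD Delta_gt0; lra.
have [m Fm mC] := coverable_covered (FC d (2 * Delta) x d0 dD2 Fx).
exists m; last by rewrite -mulrA -powR_div// mulr_ge0// ltW.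
apply: coverableS Fm => y Fy; split=> //; rewrite /eucl_cball /=.
by apply: le_trans (F_small Fx Fy) _; move: Delta_gt0; lra.
Qed.

(** The lower bound is applied at the distance of two points. A single point has no admissible
    radius, but then s = 0 and the measure is at least 1. *)
Lemma ahlfors_measure_gt0 : ahlfors_regular F -> (0 < hausdorff_measure s F)%E.
Proof.
move=> [s' [_ +]]; rewrite F_dim => -[<-] [c c1 Fc].
have [x Fx] := attractor_neq0.
have [[y [Fy xy]]|noy] := pselect (exists y, F y /\ y <> x).
  have r0 := eucl_dist_gt0 xy.
  have rF : ((eucl_dist y x)%:E <= diam F)%E.
    by apply: ereal_sup_ubound; right; exists y => //; exists x.
  have /andP[+ _] := Fc x _ Fx r0 rF => /lt_le_trans cr.
  apply: lt_le_trans
    (le_hausdorff_measure s (@subIsetl _ F (eucl_cball x (eucl_dist y x)))).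
  by apply: cr; rewrite lte_fin mulr_gt0 ?powR_gt0// invr_gt0 (lt_le_trans ltr01).
have Fx0 y : F y -> y = x by move=> Fy; apply: contrapT => yx; apply: noy; exists y.
have s0 : s = 0.
  apply/le_anti; rewrite s_ge0 andbT.
  apply: (dim_le_covered_pow (lexx 0) ltr01) => d /andP[d0 _]; exists 1%N.
    by apply: coverable_small => y z /Fx0-> /Fx0->; rewrite eucl_distxx ltW.
  by rewrite powRr0 divr1.
rewrite s0; apply: lt_le_trans (finite_content_le_measure attractor_compact (lexx _)
  (finite_content_exp0 attractor_neq0)).
by rewrite lte_fin.
Qed.

Lemma word_map_affine w : affine ('S_w).
Proof. exact: similarity_affine (word_map_dist w). Qed.

Lemma word_map_bijective w : exists h, cancel ('S_w) h /\ cancel h ('S_w).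
Proof. exact: similarity_bijective (rho_gt0 w) (word_map_dist w). Qed.

(** * Weak separation *)

Section WeakSeparation.
Hypothesis S_wsp : weak_separation S.

(** Rescaled by S_u^-1, the assumption puts S_u^-1 S_v within e of the identity on the cube, where
    weak separation leaves only the identity. *)
Lemma wsp_close_eq : exists2 e : R, 0 < e & forall u v,
  (forall y, unit_cube y -> eucl_dist ('S_u y) ('S_v y) <= e * rho u) ->
  'S_u =1 'S_v.
Proof.
move: S_wsp; rewrite /weak_separation near_identityP => /existsNP[e /not_implyP[e0 noQ]].
exists e => // u v uv; have [h [uh hu]] := word_map_bijective u.
suff hv : h \o 'S_v = id by move=> x; rewrite -[RHS]hu -[h _]/((h \o 'S_v) x) hv.
apply: contrapT => hv; apply: noQ; exists (h \o 'S_v); split=> //.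
  by exists u, v, h.
move=> y /uv uvy; rewrite -/(eucl_dist _ _) -(ler_pM2l (rho_gt0 u)).
by rewrite -word_map_dist /= hu eucl_distC mulrC.
Qed.

Let frame (k : option 'I_n) : 'rV[R]_n := if k is Some i then delta_mx 0 i else 0.

Lemma wsp_frame_eq : exists2 e : R, 0 < e & forall u v,
  (forall k, eucl_dist ('S_u (frame k)) ('S_v (frame k)) <= e * rho u) ->
  'S_u =1 'S_v.
Proof.
have [e e0 eP] := wsp_close_eq.
have n0 : 0 < 1 + 2 * n%:R :> R by rewrite ltr_pwDl// mulr_ge0.
(* The coordinates of a point of the cube sum to at most n in [affine_coord_bound]. *)
exists (e / (1 + 2 * n%:R)); first by rewrite divr_gt0.
move=> u v uv; apply: eP => y y01.
have uvA := sub_affine (word_map_affine u) (word_map_affine v).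
apply: le_trans (affine_coord_bound y uvA (uv None) (fun i => uv (Some i))) _.
have -> : e / (1 + 2 * n%:R) * rho u = e * rho u / (1 + 2 * n%:R) by rewrite mulrAC.
have eu : 0 < e * rho u by rewrite mulr_gt0 ?rho_gt0.
rewrite mulrAC ler_pdivrMr// ler_pM2l// lerD2l ler_pM2l//.
rewrite -[X in _ <= X%:R]card_ord -sumr_const; apply: ler_sum => i _.
by have /andP[y0 y1] := y01 i; rewrite ger0_norm.
Qed.

(* Words whose rescaled images of an affine frame fall into the same pieces of a
   fixed finite partition define the same map. *)
Lemma wsp_local_cylinders : exists N : nat, forall (x : 'rV[R]_n) (r : R),
  F x -> 0 < r <= 1 -> exists W : seq (seq I),
    [/\ (size W <= N)%N, forall w, w \in W -> rho w <= r &
      forall y, F y -> eucl_dist x y <= r ->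
        exists2 w, w \in W & exists2 z, F z & y = 'S_w z].
Proof.
have [e e0 eP] := wsp_frame_eq; have [x0 Fx0] := attractor_neq0.
pose K := \sum_k eucl_dist (frame k) x0 + Delta.
have KP k z : F z -> eucl_dist (frame k) z <= K.
  move=> Fz; apply: le_trans (eucl_dist_triangle x0 _ _) _; apply: lerD.
    by rewrite (bigD1 k)//= lerDl sumr_ge0// => i _; exact: eucl_dist_ge0.
  exact: F_small.
have cK : compact (eucl_cball (0 : 'rV[R]_n) (K + 1)) by exact: compact_eucl_cball.
(* With sets of size [e * cmin], two maps of the same code differ on the frame by at most
   [e * cmin * r], hence by at most [e * rho w]. *)
have [m [U [KU Um]]] := compact_covered cK (mulr_gt0 e0 cmin_gt0).
exists #|{ffun option 'I_n -> 'I_m}| => x r Fx /andP[r0 r1].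
pose cand w := [/\ rho w <= r, cmin * r <= rho w &
  exists2 z, F z & eucl_dist x ('S_w z) <= r].
pose code w (t : {ffun option 'I_n -> 'I_m}) :=
  forall k, U (t k) (r^-1 *: ('S_w (frame k) - x)).
have has_code w : cand w -> exists t, code w t.
  move=> [wr _ [z Fz xz]].
  have /choice[t tP] k : exists i, U i (r^-1 *: ('S_w (frame k) - x)).
    have [|i _] := KU (r^-1 *: ('S_w (frame k) - x)); last by exists i.
    rewrite /eucl_cball /= eucl_distC /eucl_dist subr0 eucl_normZ.
    rewrite ger0_norm ?invr_ge0 ?(ltW r0)// mulrC ler_pdivrMr//.
    apply: le_trans (eucl_dist_triangle ('S_w z) _ _) _.
    rewrite word_map_dist (eucl_distC _ x) mulrDl mul1r mulrC; apply: lerD => //.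
    by apply: ler_pM; [exact: eucl_dist_ge0|exact: ltW (rho_gt0 w)|exact: KP|].
  by exists [ffun k => t k] => k; rewrite ffunE.
have code_eq w w' t : cand w -> code w t -> code w' t -> 'S_w =1 'S_w'.
  move=> [_ wr _] wt w't; apply: eP => k.
  have := Um _ _ _ (wt k) (w't k).
  rewrite /eucl_dist -scalerBr opprB addrA subrK eucl_normZ.
  rewrite ger0_norm ?invr_ge0 ?(ltW r0)// mulrC ler_pdivrMr// => /le_trans; apply.
  by rewrite -mulrA ler_pM2l.
have [w0 w0P] : exists w, cand w.
  have [w [z [Fz xz w1 w2]]] := exists_cylinder Fx r0.
  exists w; split=> //; first by move: w2; rewrite min_l.
  by exists z => //; rewrite -xz eucl_distxx ltW.
(* A code of no candidate is represented by [w0], so that every representative obeys the ratio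
   bound. *)
have /choice[rep repP] t : exists w, cand w /\
    ((exists2 w', cand w' & code w' t) -> code w t).
  have [[w' w'c w't]|no] := pselect (exists2 w', cand w' & code w' t).
    by exists w'.
  by exists w0.
exists [seq rep t | t <- enum {: {ffun option 'I_n -> 'I_m}}]; split.
- by rewrite size_map -cardE.
- by move=> w /mapP[t _ ->]; have [[]] := repP t.
move=> y Fy xy; have [w [z [Fz yz w1 w2]]] := exists_cylinder Fy r0.
have wc : cand w.
  split=> //; first by move: w2; rewrite min_l.
  by exists z => //; rewrite -yz.
have [t wt] := has_code w wc; have [_ /(_ (ex_intro2 _ _ w wc wt)) rt] := repP t.
exists (rep t); first by rewrite map_f// mem_enum.
by exists z => //; rewrite yz; exact: (code_eq _ _ _ wc wt rt).
Qed.

(** The maps of boundedly many cylinders carry a cover of [F] to covers of their images, with sizes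
    at most [r * d]. *)
Lemma wsp_local_cover : exists2 N : nat, (0 < N)%N &
  forall (x : 'rV[R]_n) (r d : R) m, F x -> 0 < r <= 1 -> 0 <= d ->
    coverable_by F d m -> coverable_by (F `&` eucl_cball x r) (r * d) (N * m).
Proof.
have [N NP] := wsp_local_cylinders; exists N.+1 => // x r d m Fx r01 d0 Fm.
have [W [WN Wr FW]] := NP x r Fx r01.
apply: (@coverable_leq _ _ _ _ (\sum_(w <- W) m)%N).
  rewrite big_const_seq count_predT iter_addn_0 mulnC leq_mul2r.
  by rewrite (leq_trans WN) ?orbT.
apply: (coverable_bigcup (B := fun w => 'S_w @` F)) => [y [Fy xy]|w wW].
  by have [w wW [z Fz ->]] := FW y Fy xy; exists w => //; exists z.
apply: (@coverable_le_scale _ _ _ (rho w * d)); first by rewrite ler_wpM2r// Wr.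
exact: coverable_image (ltW (rho_gt0 w)) (word_map_dist w) Fm.
Qed.

(** The part of [F] in each set of the current cover lies in a ball about one of its points, where a
    local cover refines the scale by the factor r. *)
Lemma iterate_cover N (r : R) m k :
    (forall (x : 'rV[R]_n) (t d : R) m, F x -> 0 < t <= 1 -> 0 <= d ->
      coverable_by F d m -> coverable_by (F `&` eucl_cball x t) (t * d) (N * m)) ->
    (0 < N)%N -> 0 < r < 1 -> coverable_by F r m ->
  coverable_by F (r ^+ k.+1) ((N * m) ^ k.+1).
Proof.
move=> NP N0 /andP[r0 r1] Fm; elim: k => [|k [U [FU Ur]]].
  by rewrite expr1 expn1; apply: coverable_leq Fm; exact: leq_pmull.
rewrite expnS mulnC exprSr.
apply: (@coverable_leq _ _ _ _ (\sum_(i <- enum 'I_((N * m) ^ k.+1)) (N * m))%N).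
  by rewrite big_enum /= sum_nat_const card_ord.
apply: (coverable_bigcup (B := fun i => F `&` U i)) => [x Fx|i _].
  by have [i _ Uix] := FU x Fx; exists i; rewrite ?mem_enum.
have [[x [Fx Ux]]|noU] := pselect (exists x, F x /\ U i x); last first.
  apply: coverableS (coverable0 _ _) => x [Fx Ux].
  by apply: noU; exists x.
have rk1 : 0 < r ^+ k.+1 <= 1 by rewrite exprn_gt0//= exprn_ile1// ltW.
apply: coverableS (NP x _ r m Fx rk1 (ltW r0) Fm) => y [Fy Uy]; split=> //.
exact: (Ur i).
Qed.

(** If q = N * m * r^s were below 1, so would be the product at some exponent s - tau; the iterated
    covers would then have sums tending to 0, against the value of the dimension. *)
Lemma wsp_cover_lower N (r : R) m :
    (forall (x : 'rV[R]_n) (t d : R) m, F x -> 0 < t <= 1 -> 0 <= d ->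
      coverable_by F d m -> coverable_by (F `&` eucl_cball x t) (t * d) (N * m)) ->
    (0 < N)%N -> 0 < r < 1 -> coverable_by F r m ->
  1 <= (N * m)%:R * r `^ s.
Proof.
move=> NP N0 r01 Fm; have /andP[r0 r1] := r01.
have Nm0 : (0 < N * m)%N by rewrite muln_gt0 N0 (coverable_gt0 attractor_neq0 Fm).
have [s0|sN0] := eqVneq s 0; first by rewrite s0 powRr0 mulr1 ler1n.
have s_gt0 : 0 < s by rewrite lt_def sN0 s_ge0.
rewrite leNgt; apply/negP; set q := _ * _ => q1.
have q0 : 0 < q by rewrite mulr_gt0 ?ltr0n ?powR_gt0.
(* The midpoint of 1 and 1 / q keeps [th] strictly below 1. *)
have q'1 : 1 < (1 + q^-1) / 2 by have : 1 < q^-1 by [rewrite invf_gt1]; lra.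
have [tau [/andP[tau0 taus] qr]] := powR_near1 r01 q'1 s_gt0.
set p := (1 + q^-1) / 2 in q'1 qr.
have t0 : 0 <= s - tau by rewrite subr_ge0.
pose th := (N * m)%:R * r `^ (s - tau).
have th0 : 0 < th by rewrite mulr_gt0 ?ltr0n ?powR_gt0.
have th1 : th < 1.
  have rt0 := powR_gt0 tau r0.
  rewrite /th powRB ?(gt_eqF r0) ?implybT// mulrA -/q ltr_pdivrMr// mul1r.
  apply: lt_le_trans qr; rewrite -[ltLHS]invrK ltf_pV2 ?posrE ?invr_gt0//; last first.
    exact: lt_trans q'1.
  by have : 1 < q^-1 by [rewrite invf_gt1]; rewrite /p; lra.
have powto (a e : R) : 0 < a -> a < 1 -> 0 < e ->
    \forall k \near \oo, a ^+ k < e.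
  move=> a0 a1 e0; have /cvg_expr/cvgr0Pnorm_lt/(_ e e0) : `|a| < 1 by rewrite gtr0_norm.
  by apply: filterS => k; rewrite normrX gtr0_norm.
suff : s <= s - tau by rewrite leNgt ltrBlDr ltrDl tau0.
apply: (hausdorff_dim_le F_dim t0).
apply/eqP; rewrite eq_le hausdorff_measure_ge0 andbT; apply/lee_addgt0Pr => eps eps0.
rewrite add0e; apply: measure_le_covered => // d d0.
have [k [rk thk]] : exists k, r ^+ k < d /\ th ^+ k < eps.
  near \oo => k; exists k; split; near: k; exact: powto.
have rk1 : r ^+ k.+1 <= r ^+ k by rewrite ler_wiXn2l ?(ltW r0) ?(ltW r1).
have thk1 : th ^+ k.+1 <= th ^+ k by rewrite ler_wiXn2l ?(ltW th0) ?(ltW th1).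
exists (r ^+ k.+1), ((N * m) ^ k.+1)%N; split.
- by rewrite exprn_gt0//= (le_trans rk1)// ltW.
- exact: iterate_cover.
have -> : (r ^+ k.+1) `^ (s - tau) = (r `^ (s - tau)) ^+ k.+1.
  by rewrite -powR_mulrn ?(ltW r0)// powRAC powR_mulrn// powR_ge0.
rewrite natrX -exprMn; apply: le_trans thk1 _.
exact: ltW.
Unshelve. all: end_near.
Qed.

(** A cover with sizes r_j is refined to a scale d below all of them, at the cost of N * C * (r_j /
    d)^s sets each; [wsp_cover_lower] bounds the total from below and brings the second factor N. *)
Lemma wsp_content : exists2 h, 0 < h & finite_content_ge F s h.
Proof.
have [N N0 NP] := wsp_local_cover; have [C C1 FC] := attractor_covered_upper.
have C0 : 0 < C by exact: lt_le_trans C1.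
have NC1 : 1 <= N%:R ^+ 2 * C by rewrite mulr_ege1// exprn_ege1// ler1n.
have NC0 : 0 < N%:R ^+ 2 * C by exact: lt_le_trans NC1.
exists (N%:R ^+ 2 * C)^-1; first by rewrite invr_gt0.
move=> J U r r0 Ur FU.
have [/hasP[j jJ rj]|/hasPn rlt] := boolP (has (fun j => 1 <= r j) J).
  apply: (@le_trans _ _ 1); first by rewrite invf_le1.
  rewrite (big_rem j)//= -[leLHS]addr0; apply: lerD.
    by rewrite -(powRr0 (r j)); apply: ler_powR.
  by apply: sumr_ge0 => i _; exact: powR_ge0.
have [e e0 eJ] := pos_lower_bound (fun j (_ : j \in J) => r0 j).
pose d := Num.min e (1 / 2).
have d0 : 0 < d by rewrite lt_min e0 divr_gt0.
have d1 : d < 1 by rewrite gt_min; apply/orP; right; lra.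
have dJ j : j \in J -> d <= r j by move=> /eJ; rewrite ge_min => ->.
have /choice[m mP] j : exists m, j \in J ->
    coverable_by F (d / r j) m /\ m%:R <= C * (r j / d) `^ s.
  have [jJ|jJ] := boolP (j \in J); last by exists 0%N.
  have [|m Fm mC] := FC (d / r j); first by rewrite divr_gt0//= ler_pdivrMr ?mul1r ?dJ.
  by exists m => _; split=> //; rewrite -invf_div.
have Fd : coverable_by F d (\sum_(j <- J) N * m j).
  apply: (coverable_bigcup (B := fun j => F `&` U j)) => [x Fx|j jJ].
    by have [j jJ Ujx] := FU x Fx; exists j.
  have [[x [Fx Ux]]|noU] := pselect (exists x, F x /\ U j x); last first.
    apply: coverableS (coverable0 _ _) => x [Fx Ux].
    by apply: noU; exists x.
  have [Fm _] := mP j jJ.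
  have rj1 : 0 < r j <= 1 by rewrite r0 ltW// ltNge rlt.
  have := NP x (r j) _ _ Fx rj1 (ltW (divr_gt0 d0 (r0 j))) Fm.
  rewrite mulrC divfK ?gt_eqF//; apply: coverableS => y [Fy Uy]; split=> //.
  exact: (Ur j).
rewrite -[leLHS]mulr1 ler_pdivrMl//.
apply: le_trans (wsp_cover_lower NP N0 (introT andP (conj d0 d1)) Fd) _.
rewrite -big_distrr /= mulnA natrM natr_sum.
rewrite natrM -expr2 -(mulrA _ C) -(mulrA (N%:R ^+ 2)).
apply: ler_wpM2l; first exact: exprn_ge0.
rewrite mulr_suml mulr_sumr big_seq [leRHS]big_seq; apply: ler_sum => j /mP[_ mC].
by rewrite -ler_pdivlMr ?powR_gt0// -mulrA -powR_div ?(ltW (r0 j)).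
Qed.

End WeakSeparation.

(** * Failure of weak separation *)

Section NotWeaklySeparated.
Hypothesis F_hyp : ~ exists2 H : set 'rV[R]_n, affine_hyperplane H & F `<=` H.
Hypothesis S_nwsp : ~ weak_separation S.

(** The displacement D = S_u^-1 S_v - id is affine, so its size at the point y of a frame in [F]
    where it is largest bounds its variation everywhere. *)
Lemma near_identity_words : exists2 La : R, 0 < La & forall e : R, 0 < e ->
  exists (u v : seq I) (h : 'rV[R]_n -> 'rV[R]_n) (y : 'rV[R]_n),
    let D x := h ('S_v x) - x in
    [/\ cancel h ('S_u), F y, 0 < eucl_norm (D y) <= e &
      forall x x', eucl_norm (D x - D x') <= La * eucl_norm (D y) * eucl_dist x x'].
Proof.
have [Y [La [YN0 YF La0 YLa]]] := affine_frame attractor_neq0 F_hyp.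
exists La => // e e0.
pose a (y : 'rV[R]_n) := 1 + 2 * \sum_(i < n) `|y 0 i|.
have a1 y : 1 <= a y by rewrite lerDl mulr_ge0// sumr_ge0.
have a0 y : 0 <= a y := le_trans ler01 (a1 y).
pose m := \sum_(y <- Y) a y.
have am y : y \in Y -> a y <= m.
  by move=> yY; rewrite /m (big_rem y)//= lerDl sumr_ge0.
have m0 : 0 < m.
  case: (Y) YN0 am => // y Y' _ /(_ y); rewrite inE eqxx => /(_ isT).
  by apply: lt_le_trans; exact: lt_le_trans (a1 y).
move: S_nwsp; rewrite /weak_separation => /contrapT/near_identityP.
move=> /(_ (e / m) (divr_gt0 e0 m0))[_ [[u [v [h [uh hu ->]]]] gid gcube]].
have hdist x x' : eucl_dist (h x) (h x') = (rho u)^-1 * eucl_dist x x'.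
  by rewrite -{2}[x]hu -{2}[x']hu word_map_dist mulKf// gt_eqF ?rho_gt0.
have Daff : affine (fun x => h ('S_v x) - x).
  apply/sub_id_affine/(similarity_affine (c := (rho u)^-1 * rho v)) => x x'.
  by rewrite hdist word_map_dist mulrA.
pose D x := h ('S_v x) - x.
have [y yY ymax] : exists2 y, y \in Y & forall y', y' \in Y ->
    eucl_norm (D y') <= eucl_norm (D y).
  elim: (Y) YN0 => // y0 Y' IH _; case: (Y') IH => [_|y1 Y'' /(_ isT)[y yY ymax]].
    by exists y0; rewrite ?inE ?eqxx// => y'; rewrite inE => /eqP->.
  have [y0y|/ltW yy0] := leP (eucl_norm (D y0)) (eucl_norm (D y)).
    exists y; first by rewrite inE yY orbT.
    by move=> y'; rewrite inE => /predU1P[->|/ymax].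
  exists y0; first by rewrite inE eqxx.
  move=> y'; rewrite inE => /predU1P[->//|/ymax y'y]; exact: le_trans yy0.
have DLa := YLa _ _ Daff ymax.
exists u, v, h, y; split=> //; first exact: YF.
apply/andP; split.
  (* If D vanished at y, it would vanish everywhere and the quotient map would be the identity. *)
  rewrite lt_def eucl_norm_ge0 andbT; apply/eqP => Dy0; apply: gid.
  apply/funext => x /=; apply/eqP; rewrite -subr_eq0; apply/eqP/eucl_norm_eq0.
  apply/le_anti; rewrite eucl_norm_ge0 andbT.
  have := DLa x y; rewrite Dy0 mulr0 mul0r.
  by rewrite (eucl_norm_eq0 Dy0) subr0.
apply: le_trans (affine_coord_bound y Daff (e := e / m) _ _) _.
- by apply: gcube; exact: unit_cube0.
- by move=> i; apply: gcube; exact: unit_cube_delta.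
- by rewrite mulrAC ler_pdivrMr// ler_pM2l//; exact: am.
Qed.

(** A vector of norm at least 1 has a coordinate of size at least 2 * gap, half of which may be lost
    to an error; [step] allows a displacement of length 1 / cmin and an error of at most 1. *)
Let gap : R := (2 * n.+1%:R)^-1.
Let step : R := cmin^-1 + 1.

(* The points [p j], magnified by [S_t], form a chain in [F] that progresses in
   the direction of a signed coordinate axis. *)
Let has_chain t (c : 'I_n * bool) k := exists p : nat -> 'rV[R]_n,
  (forall j, (j <= k)%N -> F ('S_t (p j))) /\
  forall j, (j < k)%N -> gap <= (-1) ^+ c.2 * (p j.+1 - p j) 0 c.1 /\
    eucl_dist (p j) (p j.+1) <= step.

Lemma gap_gt0 : 0 < gap. Proof. by rewrite invr_gt0 mulr_gt0. Qed.

(* Let [p] be the last point of a chain, magnified by a cylinder [S_t]. Prefixing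
   [t] with a long word [w] and then with [u] or [v], where [S_u^-1 S_v] is very
   close to the identity, moves [p] by the vector [g], which hardly depends on
   [p] and whose length is normalized by the choice of [w]. *)
Lemma extend_chain t (K : 'I_n * bool -> nat) : (forall c, has_chain t c (K c)) ->
  exists c0 t', forall c, has_chain t' c (K c + (c == c0)).
Proof.
move=> tK; have [La La0 LaP] := near_identity_words.
have rt0 := rho_gt0 t.
(* The first bound makes the ratio M / rho t at most 1; the second keeps the error after
   magnification at most [gap]. *)
have e0 : 0 < Num.min (rho t) (gap * rho t / (La * Delta)).
  by rewrite lt_min rt0 divr_gt0 ?mulr_gt0// gap_gt0.
have [u [v [h [y [hu Fy]]]]] := LaP _ e0.
set D := fun x => h ('S_v x) - x; rewrite -/(D y).
set M := eucl_norm (D y) => /andP[M0]; rewrite le_min => /andP[Mt Mgap] DLa.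
(* The ratio of [w ++ t] then lies between [cmin * M] and M, so the rescaled displacement g has
   length between 1 and 1 / cmin. *)
have [w [z [Fz yz w1 w2]]] := exists_cylinder Fy (divr_gt0 M0 rt0).
move: w2; rewrite min_l ?ler_pdivrMr ?mul1r// => w2.
have rw0 := rho_gt0 w; have rwt0 := rho_gt0 (w ++ t).
have [k [Sk kS]] := word_map_bijective (w ++ t).
have [A [b SA]] := word_map_affine (w ++ t).
have normA x : eucl_norm (x *m A) = rho (w ++ t) * eucl_norm x.
  have := word_map_dist (w ++ t) x 0.
  by rewrite !SA mul0mx add0r /eucl_dist addrK subr0.
pose g := k (D y + b).
have gA : g *m A = D y by have := kS (D y + b); rewrite SA => /addIr.
have gnorm : rho (w ++ t) * eucl_norm g = M by rewrite -normA gA.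
have g1 : 1 <= eucl_norm g.
  rewrite -(ler_pM2l rwt0) mulr1 gnorm rho_cat -ler_pdivlMr//.
have g2 : eucl_norm g <= cmin^-1.
  rewrite -(ler_pM2l rwt0) gnorm rho_cat ler_pdivlMr// -ler_pdivrMr//.
  by rewrite -mulrA mulrCA.
(* Chosen so that S_u S_(w ++ t) maps q p to S_v S_(w ++ t) p, a point of [F] whenever S_t p is
   one. *)
pose q p := k (h ('S_v ('S_(w ++ t) p))).
have qA p : (q p - p) *m A = D ('S_(w ++ t) p).
  have := kS (h ('S_v ('S_(w ++ t) p))); rewrite -/(q p) {1}SA => qp.
  by rewrite mulmxBl /D -qp SA opprD addrACA subrr addr0.
have qg p : F ('S_t p) -> eucl_norm (q p - p - g) <= gap.
  move=> Fp; rewrite -(ler_pM2l rwt0) -normA mulmxBl qA gA.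
  apply: le_trans (DLa _ _) _; rewrite -/M word_map_cat yz word_map_dist.
  set d := eucl_dist _ _; have dD : d <= Delta by exact: F_small.
  have -> : La * M * (rho w * d) = rho w * (La * M * d) by ring.
  rewrite rho_cat -(mulrA (rho w)) ler_pM2l//.
  apply: (@le_trans _ _ (La * M * Delta)).
    by apply: ler_wpM2l => //; rewrite mulr_ge0// ltW.
  rewrite (mulrC (rho t)); move: Mgap; rewrite ler_pdivlMr ?mulr_gt0//.
  by rewrite mulrA (mulrC M).
have [i gi] : exists i, 2 * gap <= `|g 0 i|.
  apply: contrapT => /forallNP gi.
  have : eucl_norm g <= n%:R * (2 * gap).
    apply: le_trans (eucl_norm_le_sum g) _.
    rewrite -[n in n%:R]card_ord mulr_natl -sumr_const; apply: ler_sum => i _.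
    by apply: ltW; rewrite ltNge; exact/negP/gi.
  apply/negP; rewrite -ltNge; apply: lt_le_trans g1.
  have -> : 2 * gap = n.+1%:R^-1.
    by rewrite /gap invfM mulrA divff ?mul1r// pnatr_eq0.
  by rewrite ltr_pdivrMr// mul1r ltr_nat.
pose c0 := (i, g 0 i < 0).
have gsign : (-1) ^+ c0.2 * g 0 c0.1 = `|g 0 i|.
  by rewrite -normrEsign.
exists c0, (u ++ (w ++ t)) => c; have [p [pF pP]] := tK c.
have addgK x : x = g + (x - g) by rewrite addrCA subrr addr0.
have p'F j : (j <= K c)%N -> F ('S_(u ++ (w ++ t)) (p j)).
  by move=> /pF Fp; rewrite !word_map_cat; do 2! apply: word_map_attractor.
(* Only the chain in direction [c0] gets a new point, q of its last one; the others are kept under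
   the longer prefix. *)
have [cc0|cc0] := eqVneq c c0; last by rewrite addn0; exists p; split.
exists (fun j => if (j <= K c)%N then p j else q (p (K c))); split=> j.
  rewrite addn1 leq_eqVlt => /predU1P[->|].
    rewrite ltnn word_map_cat /q kS hu; apply: word_map_attractor.
    by rewrite word_map_cat; apply: word_map_attractor; exact: pF.
  by rewrite ltnS => jK; rewrite jK; exact: p'F.
rewrite addn1 ltnS => jK; have {jK}[->|jK] : j = K c \/ (j < K c)%N.
    by move: jK; rewrite leq_eqVlt => /predU1P.
  2: by rewrite jK (ltnW jK); exact: pP.
rewrite ltnn leqnn; have Fp := pF _ (leqnn (K c)); have qgp := qg _ Fp.
rewrite (addgK (q (p (K c)) - p (K c))).
split.
  move: qgp; set d := (q _ - _ - g) => qgp; clearbody d.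
  rewrite mxE mulrDr cc0 gsign /=; have := coord_le_eucl_norm d i.
  have : - `|d 0 i| <= (-1) ^+ (g 0 i < 0)%R * d 0 i.
    by rewrite lerNl; apply: le_trans (ler_norm _) _; rewrite normrN normrMsign.
  move=> sd /le_trans/(_ qgp) dgap.
  rewrite -[leLHS](_ : 2 * gap - gap = gap); last by rewrite mulr_natl mulr2n addrK.
  by apply: lerD => //; apply: le_trans sd; rewrite lerN2.
rewrite eucl_distC /eucl_dist.
rewrite (addgK (q (p (K c)) - p (K c))).
apply: le_trans (eucl_norm_triangle _ _) _; apply: lerD => //.
apply: le_trans qgp _; rewrite invf_le1 ?mulr_gt0//.
by rewrite mulr_ege1// ler1n.
Qed.

(** Each extension lengthens one of 2 * n chains, so after 2 * n * k + 1 of them some chain has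
    length at least k. *)
Lemma long_chain k : exists t c, has_chain t c k.
Proof.
have grow N : exists K : 'I_n * bool -> nat, (\sum_c K c = N)%N /\
    exists t, forall c, has_chain t c (K c).
  elim: N => [|N [K [KN [t tK]]]].
    exists (fun=> 0); split; first by rewrite big1.
    have [x Fx] := attractor_neq0.
    by exists [::] => c; exists (fun=> x); split.
  have [c0 [t' tK']] := extend_chain tK.
  exists (fun c => K c + (c == c0))%N; split; last by exists t'.
  by rewrite big_split /= KN (bigD1 c0)//= eqxx big1 ?addn0 ?addn1// => c /negbTE->.
have [K [KN [t tK]]] := grow (#|{: 'I_n * bool}| * k).+1.
have [c kc] : exists c, (k <= K c)%N.
  apply: contrapT => /forallNP Kk.
  suff : (\sum_c K c <= #|{: 'I_n * bool}| * k)%N by rewrite KN ltnn.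
  rewrite -sum_nat_const; apply: leq_sum => c _.
  by apply: ltnW; rewrite ltnNge; exact/negP/Kk.
exists t, c; have [p [pF pP]] := tK c; exists p; split=> j jk.
  by apply: pF; exact: leq_trans kc.
by apply: pP; exact: leq_trans kc.
Qed.

(** Sets of half the gap contain at most one point of a chain, so its k + 1 points need more than k
    sets, while the ratio of the scales is a constant times k. *)
Lemma chain_assouad_exponent a : 0 <= a -> assouad_exponent F a ->
  exists2 Q : R, 0 < Q & forall k : nat, (0 < k)%N -> k%:R <= Q * k%:R `^ a.
Proof.
move=> a0 [C C0 FC]; have g0 := gap_gt0.
have s1 : 1 <= step by rewrite lerDr invr_ge0 ltW.
have s0 : 0 < step by exact: lt_le_trans s1.
have gs0 : 0 < 2 * step / gap by rewrite divr_gt0// mulr_gt0.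
exists (C * (2 * step / gap) `^ a); first by rewrite mulr_gt0 ?powR_gt0.
move=> k k0; have [t [[i b] [p [pF pP]]]] := long_chain k.
have rt0 := rho_gt0 t; have k0' : 0 < k%:R :> R by rewrite ltr0n.
have k1 : 1 <= k%:R :> R by rewrite ler1n.
(* This coordinate increases along the chain, so any two points, not only consecutive ones, are at
   least [gap] apart. *)
pose f j := (-1) ^+ b * p j 0 i.
have fgap j l : (j < l)%N -> (l <= k)%N -> gap <= f l - f j.
  elim: l => // l IH; rewrite ltnS leq_eqVlt => /predU1P[->|jl] lk.
    by have [+ _] := pP l lk; rewrite /= mxE mulrDr mxE mulrN.
  have [+ _] := pP l lk; rewrite /= mxE mulrDr mxE mulrN -/(f l) -/(f l.+1).
  by have := IH jl (ltnW lk); move: g0; lra.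
have pgap j l : (j < l)%N -> (l <= k)%N -> gap <= eucl_dist (p l) (p j).
  move=> jl lk; apply: le_trans (fgap j l jl lk) _.
  apply: le_trans (coord_le_eucl_norm _ i); rewrite /f -mulrBr.
  by apply: le_trans (ler_norm _) _; rewrite normrMsign !mxE.
have pstep j : (j <= k)%N -> eucl_dist (p 0%N) (p j) <= j%:R * step.
  elim: j => [|j IH] jk; first by rewrite eucl_distxx mul0r.
  apply: le_trans (eucl_dist_triangle (p j) _ _) _.
  rewrite -natr1 mulrDl mul1r; apply: lerD; first exact: IH (ltnW jk).
  by have [] := pP j jk.
have r0 : 0 < rho t * (gap / 2) by rewrite mulr_gt0// divr_gt0.
have rr' : rho t * (gap / 2) < rho t * (k%:R * step).
  rewrite ltr_pM2l//; apply: (@lt_le_trans _ _ 1); last by rewrite mulr_ege1.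
  rewrite ltr_pdivrMr// mul1r; apply: (@le_lt_trans _ _ 1); last by lra.
  by rewrite invf_le1 ?mulr_gt0// mulr_ege1// ler1n.
have [m [U [PU Um]] mC] := coverable_covered (FC _ _ _ r0 rr' (pF 0%N (leq0n k))).
have PU' (j : 'I_k.+1) : exists l, U l ('S_t (p j)).
  have jk : (j <= k)%N by rewrite -ltnS.
  have [|l _ Ul] := PU ('S_t (p j)); last by exists l.
  split; first exact: pF.
  rewrite /eucl_cball /= word_map_dist ler_pM2l//.
  by apply: le_trans (pstep j jk) _; rewrite ler_pM2r// ler_nat.
have [l lP] := choice PU'.
have noeq (j j' : 'I_k.+1) : (j < j')%N -> l j != l j'.
  move=> jj'; apply/eqP => lj; have Uj := lP j; rewrite lj in Uj.
  have := Um _ _ _ (lP j') Uj; rewrite word_map_dist ler_pM2l//.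
  have := pgap j j' jj' (ltn_ord j'); move: g0; lra.
have linj : injective l.
  move=> j j' lj; apply/val_inj; case: (ltngtP j j') => // /noeq; rewrite lj eqxx//.
have := leq_card l linj; rewrite !card_ord => km.
apply: (@le_trans _ _ m%:R); first by rewrite ler_nat ltnW.
apply: le_trans mC _; rewrite -(mulrA C) ler_pM2l// -powRM ?(ltW gs0)//.
have -> : rho t * (k%:R * step) / (rho t * (gap / 2)) = 2 * step / gap * k%:R.
  by field; rewrite !gt_eqF.
by [].
Qed.

Lemma assouad_exponent_ge1 a : 0 <= a -> assouad_exponent F a -> 1 <= a.
Proof.
move=> a0 /(chain_assouad_exponent a0)[Q Q0 QP].
rewrite leNgt; apply/negP => a1; have a1' : 0 < 1 - a by rewrite subr_gt0.
(* For this k the power k^(1 - a) exceeds Q. *)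
pose k := (Num.bound (Q `^ (1 - a)^-1)).+1.
have kQ : Q `^ (1 - a)^-1 < k%:R.
  apply: lt_trans (archi_boundP (powR_ge0 _ _)) _.
  by rewrite ltr_nat.
have k0 : 0 < k%:R :> R by rewrite ltr0n.
have : Q < k%:R `^ (1 - a).
  have -> : Q = (Q `^ (1 - a)^-1) `^ (1 - a).
    by rewrite -powRrM mulVf ?gt_eqF// powRr1// ltW.
  by apply: gt0_ltr_powR; rewrite ?nnegrE ?powR_ge0// ltW.
rewrite powRB ?(gt_eqF k0) ?implybT// powRr1 ?(ltW k0)// ltr_pdivlMr ?powR_gt0//.
by rewrite ltNge QP.
Qed.

Lemma assouad_dim_ge1 : (1 <= assouad_dim F)%E.
Proof.
apply: le_ereal_inf_tmp => _ [a [a0 aF] <-]; rewrite lee_fin.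
exact: assouad_exponent_ge1.
Qed.

End NotWeaklySeparated.

End IFS.

(** * The cycle of implications between the five conditions *)

Theorem corollary3p2 (R : realType) (n : nat) (I : finType)
    (S : I -> 'rV[R]_n -> 'rV[R]_n) (F : set 'rV[R]_n) (s : R)
    (S_sim : forall i, contracting_similarity (S i))
    (F_attr : attractor S F)
    (F_dim : hausdorff_dim F = s%:E)
    (s_lt1 : s < 1)
    (F_hyp : ~ exists2 H : set 'rV[R]_n, affine_hyperplane H & F `<=` H) :
  [<-> weak_separation S;
       (0 < hausdorff_measure s F)%E;
       (0 < hausdorff_measure s F < +oo)%E;
       ahlfors_regular F;
       hausdorff_dim F = assouad_dim F].
Proof.
have /choice[ratio ratioP] i : exists c, 0 < c < 1 /\
    forall x y, eucl_dist (S i x) (S i y) = c * eucl_dist x y.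
  by have [c c01 Sc] := S_sim i; exists c.
have ratio_sim i := (ratioP i).2.
have [cmin cmin0 cminP] : exists2 e, 0 < e & forall i, i \in enum I -> e <= ratio i.
  by apply: pos_lower_bound => i _; have [/andP[]] := ratioP i.
have ratio_ge i : cmin <= ratio i by apply: cminP; rewrite mem_enum.
(* [1 - e] will serve as [cmax]. *)
have [e e0 eP] : exists2 e, 0 < e & forall i, i \in enum I -> e <= 1 - ratio i.
  by apply: pos_lower_bound => i _; have [/andP[]] := ratioP i; rewrite subr_gt0.
have ratio_le i : ratio i <= 1 - e by rewrite lerBrDl -lerBrDr eP// mem_enum.
have cmax1 : 1 - e < 1 by rewrite ltrBlDr ltrDl.
have Fneq0 : F !=set0 by case: F_attr.
have Fcompact : compact F by case: F_attr.
have [Delta Delta0 FD] : exists2 D, 0 < D & small F D.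
  have [M [_ FM]] := compact_bounded Fcompact.
  have {}FM x : F x -> `|x| <= `|M| + 1.
    by apply: FM; rewrite (le_lt_trans (ler_norm M))// ltrDl.
  have M0 : 0 <= `|M| by [].
  exists (n%:R * (2 * (`|M| + 1)) + 1).
    by rewrite ltr_wpDl// mulr_ge0// mulr_ge0// addr_ge0.
  move=> x y Fx Fy; apply: le_trans (eucl_norm_le_mx_norm _) _.
  rewrite ler_wpDr// ler_wpM2l//; apply: le_trans (ler_normB _ _) _.
  by have := FM x Fx; have := FM y Fy; lra.
have s0 := hausdorff_dim_ge0 F_dim.
tfae.
- move=> wsp; have [h h0 Fh] := wsp_content ratio_sim cmin0 ratio_ge ratio_le cmax1
    F_attr Delta0 FD F_dim wsp.
  by apply: lt_le_trans (finite_content_le_measure Fcompact s0 Fh); rewrite lte_fin.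
- move=> F0; have [h h0 Fh] := measure_gt0_finite_content s0 Fneq0 F0.
  rewrite F0; exact: (content_measure_fin ratio_sim cmin0 ratio_ge ratio_le cmax1
    F_attr Delta0 FD F_dim h0 Fh).
- move=> /andP[F0 _]; have [h h0 Fh] := measure_gt0_finite_content s0 Fneq0 F0.
  exact: (content_ahlfors_regular ratio_sim cmin0 ratio_ge ratio_le cmax1
    F_attr Delta0 FD F_dim h0 Fh).
- move=> /(ahlfors_measure_gt0 F_attr Delta0 F_dim) F0.
  have [h h0 Fh] := measure_gt0_finite_content s0 Fneq0 F0.
  have /le_anti -> // : (assouad_dim F <= s%:E <= assouad_dim F)%E.
  rewrite (dim_le_assouad F_attr Delta0 FD F_dim) andbT.
  apply: ereal_inf_lbound; exists s => //; split=> //.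
  exact: (content_assouad_exponent ratio_sim cmin0 ratio_ge ratio_le cmax1
    F_attr Delta0 FD F_dim h0 Fh).
(* Failure of weak separation forces Assouad dimension at least 1, which exceeds s. *)
- move=> dimE; apply: contrapT => nwsp.
  have := assouad_dim_ge1 ratio_sim cmin0 ratio_ge ratio_le cmax1 F_attr Delta0 FD
    F_hyp nwsp.
  by rewrite -dimE F_dim lee_fin leNgt s_lt1.
Qed.
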